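(* Let $n\ge 2$ and let $m=(m_1,\ldots,m_n)$ be a vector of positive integers with $m_1\ge m_2\ge\cdots\ge m_n$. Put $\tilde n=\sum_{i=1}^n m_i$. Suppose that $m_1\le\sum_{i=2}^n m_i$ and $\tilde n\ge 2n-2$. Then there exists a nonempty Zariski open subset $U\subset(\mathbb{CP}^1)^n$ such that for every $n$-tuple $(p_1,\ldots,p_n)\in U$ of pairwise distinct points, the multi-arrangement $\tilde{\mathcal A}$ consisting of the points $p_1,\ldots,p_n$ with multiplicities $m_1,\ldots,m_n$ respectively has exponents $$\exp(\tilde{\mathcal A})=\left(\left\lfloor \tfrac12\tilde n\right\rfloor,\left\lceil\tfrac12\tilde n\right\rceil\right).$$
   Context: Let $S=\mathbb C[x,y]$ be the symmetric algebra of the dual of $V=\mathbb C^2$. A multi-arrangement $\tilde{\mathcal A}$ in $\mathbb{CP}^1$ is a set of $n\geq 2$ pairwise distinct points $p_1,\ldots,p_n$ of $\mathbb{CP}^1$ (lines through the origin in $V$) together with positive integer multiplicities $m_1,\ldots,m_n$. For each $i$ let $\alpha_i\in V^*$ be a nonzero linear form with $\ker\alpha_i=p_i$. Its module of derivations is the graded $S$-module $$D(\tilde{\mathcal A})=\{\theta\in \mathrm{Der}_{\mathbb C}(S)\mid \theta(\alpha_i)\in\alpha_i^{m_i}S\ \text{ for all } i\}.$$ A nonzero derivation $f\partial_x+g\partial_y$ is homogeneous of degree $d$ if $f$ and $g$ are each zero or homogeneous polynomials of degree $d$. The module $D(\tilde{\mathcal A})$ is always free of rank 2 with a homogeneous basis;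 the degrees $e_1\le e_2$ of the elements of a homogeneous basis are uniquely determined, and $\exp(\tilde{\mathcal A})=(e_1,e_2)$ is called the exponents of $\tilde{\mathcal A}$. *)

(* Defs.v *)
From mathcomp Require Import all_boot all_order all_algebra.
From mathcomp Require Import reals.
From mathcomp Require Import complex.
From mathcomp Require Import mpoly.

Set Implicit Arguments.
Unset Strict Implicit.
Unset Printing Implicit Defensive.

Import GRing.Theory.
Local Open Scope ring_scope.

Section Projective.
Variable K : fieldType.

(* Lines through the origin of V = K^2. *)
Definition proj_line : Type := {L : {vspace 'rV[K]_2} | (\dim L == 1)%N}.

(* Row i of v : 'M_(n, 2) is a pair of homogeneous coordinates of p i. *)
Definition homog_coords n (p : 'I_n -> proj_line) (v : 'M[K]_(n, 2)) : Prop :=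
  forall i, row i v != 0 /\ row i v \in val (p i).

(* Polynomials in the n pairs of homogeneous coordinates: the j-th variable of
   the i-th pair has index mxvec_index i j, so that F evaluates at mxvec v. *)
Definition multihomog n (d : 'I_n -> nat) (F : {mpoly K[n * 2]}) : Prop :=
  forall mon, mon \in msupp F ->
  forall i, (\sum_(j < 2) mon (mxvec_index i j))%N = d i.

(* F must be multihomogeneous for this not to depend on the coordinates. *)
Definition vanishes_at n (F : {mpoly K[n * 2]}) (p : 'I_n -> proj_line) : Prop :=
  forall v, homog_coords p v -> F.@[mxvec v 0] = 0.

(* Closed sets are those of the product variety (zero loci of families of
   multihomogeneous polynomials), not those of the product topology. *)
Definition zariski_closed n (Z : ('I_n -> proj_line) -> Prop) : Prop :=
  exists E : {mpoly K[n * 2]} -> Prop,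
    (forall F, E F -> exists d, multihomog d F) /\
    (forall p, Z p <-> forall F, E F -> vanishes_at F p).

Definition zariski_open n (U : ('I_n -> proj_line) -> Prop) : Prop :=
  zariski_closed (fun p => ~ U p).

End Projective.

Section Derivations.
Variable K : fieldType.
Local Notation S := {mpoly K[2]}.

Definition derivation (theta : S -> S) : Prop :=
  linear theta /\ forall f g, theta (f * g) = theta f * g + f * theta g.

Definition homog_derivation (d : nat) (theta : S -> S) : Prop :=
  [/\ derivation theta, exists f, theta f != 0
    & forall i : 'I_2, theta 'X_i \is d.-homog].

Definition defining_form (p : proj_line K) (alpha : S) : Prop :=
  [/\ alpha != 0, alpha \is 1.-homog
    & forall v : 'rV[K]_2, v \in val p <-> alpha.@[v 0] = 0].

(* The forms defining a given line are the nonzero scalar multiples of one of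
   them, so quantifying over all of them amounts to choosing one. *)
Definition der_module n (p : 'I_n -> proj_line K) (m : 'I_n -> nat)
    (theta : S -> S) : Prop :=
  derivation theta /\
  forall i alpha, defining_form (p i) alpha ->
    exists g, theta alpha = alpha ^+ m i * g.

Definition basis2 (D : (S -> S) -> Prop) (theta1 theta2 : S -> S) : Prop :=
  [/\ D theta1 /\ D theta2,
      forall theta, D theta ->
        exists a b : S, forall f, theta f = a * theta1 f + b * theta2 f
    & forall a b : S, (forall f, a * theta1 f + b * theta2 f = 0) ->
        a = 0 /\ b = 0].

Definition exponents n (p : 'I_n -> proj_line K) (m : 'I_n -> nat)
    (e : nat * nat) : Prop :=
  (e.1 <= e.2)%N /\
  exists theta1 theta2 : S -> S,
    [/\ basis2 (der_module p m) theta1 theta2,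
        homog_derivation e.1 theta1 & homog_derivation e.2 theta2].

End Derivations.

(* Main.v *)
From HB Require Import structures.
Require Import Defs.
From mathcomp Require Import all_boot all_order all_algebra.
From mathcomp Require Import reals.
From mathcomp Require Import complex.
From mathcomp Require Import mpoly.
From mathcomp Require Import perm boolp.
From mathcomp Require Import zify ring.

Set Implicit Arguments.
Unset Strict Implicit.
Unset Printing Implicit Defensive.

Import Order.TTheory GRing.Theory Num.Theory.
Local Open Scope ring_scope.

(** The degrees of a homogeneous basis of D(A) add up to the total multiplicity
N, so the exponents are balanced as soon as D(A) has no nonzero element of
degree less than N/2.  For N = 2k, and for points with nonzero first
coordinate, dehomogenizing turns this into a statement about pairs (f, g) of
univariate polynomials of degree less than k: if (X - t_i)^{m_i} divides
g - t_i f for every i, then f = g = 0; such points t_i are called rigid here.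
Adding the quotients w_i to the unknowns gives a linear system with as many
equations as unknowns ([card_unknown]), whose determinant is a multihomogeneous
polynomial in the coordinates of the points ([multihomog_det_sysmx]).  Its nonvanishing, together
with that of the first coordinates, defines the open set U; the work lies in
showing that U is nonempty and that rigidity gives the exponents.

Nonemptiness ([rigid_points_exist]) goes by induction on the number of points,
through degenerations.  If a family of systems depending polynomially on a
parameter is singular for almost all values, then it has a polynomial solution
that does not vanish at 0 ([degeneration]).  When two points t and t + eps
collide, the limit of such a solution can be computed ([collision]).  If their
multiplicities are d + s and s with d > 0, the limit is (X - t)^s times a
solution for a single point of multiplicity d, so rigidity of the merged
multiplicities implies rigidity of the original ones ([rigid_points_merge]).
Merging a point of largest multiplicity with one of smallest multiplicity
reduces everything to at most three points, with three points put at 0, 1 and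
infinity ([rigid_points3]), or to the case where all multiplicities are equal
to some c > 1.  Then two points are made to collide at a point q.  If 2k is the
total multiplicity of the other points, the limit is a solution (f, g) of
degree at most k for these, subject to two linear conditions at q.
Such solutions form a plane; if the two conditions were dependent on it for
every q, an identity of Wronskian type would yield a formula for the derivative
of the product Q of the (X - t_i)^{m_i} that contradicts its leading
coefficient ([wronskian_absurd]).

Conversely, rigidity makes the square system surjective, which produces two
solutions of degree k with prescribed leading coefficients ([frame_exists]),
and their determinant is exactly Q ([frame_det]).  By the criterion of Saito
([saito]) their homogenizations form a basis of D(A).  If N is odd, one copy of
the point of largest multiplicity is removed first, and the basis obtained is
modified at that point ([frame_succ]). *)

(** * The square linear system of a configuration *)

Section System.
Variables (n k : nat) (m : 'I_n -> nat).

(** Coefficients of f, of g and of the quotients w_i in the equations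
a_i g - b_i f = (a_i X - b_i)^{m_i} w_i. *)
Definition unknown : finType := ('I_k + 'I_k + {i : 'I_n & 'I_(k - m i)})%type.

(** The pair (i, j) stands for the coefficient of X^j in equation i. *)
Definition equation : finType := ('I_n * 'I_k)%type.

Hypothesis le_mk : forall i, (m i <= k)%N.
Hypothesis sum_m : (\sum_i m i = k.*2)%N.

(** This is where the total multiplicity has to be 2k: there are
2k + (nk - 2k) unknowns for nk equations. *)
Lemma card_unknown : #|equation| = #|unknown|.
Proof.
rewrite !card_sum card_tagged card_prod !card_ord sumnE big_map big_enum /=.
rewrite (eq_bigr (fun i => k - m i)%N); last by move=> i _; rewrite card_ord.
have: (\sum_i (k - m i) + \sum_i m i = n * k)%N.
  rewrite -big_split /= (eq_bigr (fun=> k)) ?sum_nat_const ?card_ord //.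
  by move=> i _; rewrite subnK.
by rewrite sum_m -addnn => <-; rewrite addnC; congr (_ + _)%N; apply: eq_bigl.
Qed.

Section Ring.
Variable R : comNzRingType.
Variables a b : 'I_n -> R.

Definition lform i : {poly R} := a i *: 'X - (b i)%:P.

(** Contribution of one unknown to equation i, written in the form
a_i g - b_i f - (a_i X - b_i)^{m_i} w_i = 0. *)
Definition column (u : unknown) (i : 'I_n) : {poly R} :=
  match u with
  | inl (inl j) => - b i *: 'X^j
  | inl (inr j) => a i *: 'X^j
  | inr (existT i' j) => if i' == i then - lform i ^+ m i * 'X^j else 0
  end.

Definition sysmx : 'M[R]_#|equation| :=
  \matrix_(r, c) let e : equation := enum_val c in
    (column (enum_val (cast_ord card_unknown r)) e.1)`_e.2.

Lemma size_lform i : (size (lform i) <= 2)%N.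
Proof.
rewrite /lform; apply: leq_trans (size_polyD _ _) _; rewrite geq_max size_polyN.
rewrite (leq_trans (size_scale_leq _ _)) ?size_polyX //=.
by rewrite (leq_trans (size_polyC_leq1 _)).
Qed.

Lemma size_column u i : (size (column u i) <= k)%N.
Proof.
case: u => [[j|j]|[i' j]] /=.
- by rewrite (leq_trans (size_scale_leq _ _)) ?size_polyXn //=.
- by rewrite (leq_trans (size_scale_leq _ _)) ?size_polyXn //=.
case: eqP => [eq_i|_]; last by rewrite size_poly0.
subst i'; rewrite mulNr size_polyN (leq_trans (size_polyMleq _ _)) //.
rewrite size_polyXn addnS /=.
have := size_poly_exp_leq (lform i) (m i); have := size_lform i.
have := ltn_ord j; have := le_mk i; move: (size _) (size _) => x y /=.
by nia.
Qed.

Definition uvec (x : unknown -> R) : 'rV[R]_#|equation| :=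
  \row_r x (enum_val (cast_ord card_unknown r)).
Definition uncoef (v : 'rV[R]_#|equation|) (u : unknown) : R :=
  v 0 (cast_ord (esym card_unknown) (enum_rank u)).

Lemma uvecK v : uvec (uncoef v) = v.
Proof. by apply/rowP => r; rewrite mxE /uncoef enum_valK cast_ordK. Qed.

Lemma uncoef_inj v : (forall u, uncoef v u = 0) -> v = 0.
Proof. by move=> v0; rewrite -(uvecK v); apply/rowP => r; rewrite !mxE v0. Qed.

Lemma mul_uvec_sysmx x c :
  (uvec x *m sysmx) 0 c =
  let e : equation := enum_val c in (\sum_u x u *: column u e.1)`_e.2.
Proof.
rewrite /= mxE coef_sum.
rewrite (reindex (fun u => cast_ord (esym card_unknown) (enum_rank u))) /=.
  apply: eq_bigr => u _; rewrite !mxE cast_ordKV enum_rankK coefZ //.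
exists (fun r => enum_val (cast_ord card_unknown r)) => u _.
  by rewrite cast_ordKV enum_rankK.
by rewrite enum_valK cast_ordK.
Qed.

Definition fpart (x : unknown -> R) : {poly R} := \sum_(j < k) x (inl (inl j)) *: 'X^j.

Definition gpart (x : unknown -> R) : {poly R} := \sum_(j < k) x (inl (inr j)) *: 'X^j.

Definition wpart (x : unknown -> R) (i : 'I_n) : {poly R} :=
  \sum_(j < k - m i) x (inr (Tagged (fun i => 'I_(k - m i)) j)) *: 'X^j.

Lemma sum_column x i :
  \sum_u x u *: column u i =
  a i *: gpart x - b i *: fpart x - lform i ^+ m i * wpart x i.
Proof.
rewrite !big_sumType /= !scaler_sumr mulr_sumr -!sumrN [X in X + _]addrC.
congr (_ + _ + _); first by apply: eq_bigr => j _; rewrite !scalerA mulrC.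
  by apply: eq_bigr => j _; rewrite !scalerA mulrN mulrC scaleNr.
pose wcoef i' (j : 'I_(k - m i')) := x (inr (Tagged (fun i => 'I_(k - m i)) j)).
pose G i' (j : 'I_(k - m i')) : {poly R} :=
  wcoef i' j *: (if i' == i then - lform i ^+ m i * 'X^j else 0).
rewrite (eq_bigr (fun u : {i : 'I_n & 'I_(k - m i)} => G (tag u) (tagged u)));
  last by case=> i' j _.
rewrite -(@sig_big_dep _ _ _ _ (fun i => 'I_(k - m i)) xpredT (fun _ => xpredT) G) /=.
rewrite /G /wcoef.
rewrite (bigD1 i) //= [X in _ + X]big1 ?addr0; last first.
  by move=> i' /negbTE ->; rewrite big1 // => j _; rewrite scaler0.
by apply: eq_bigr => j _; rewrite eqxx -scalerAr mulNr scalerN.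
Qed.

Lemma polyP_lt (p q : {poly R}) : (size p <= k)%N -> (size q <= k)%N ->
  (forall j : 'I_k, p`_j = q`_j) -> p = q.
Proof.
move=> sp sq pq; apply/polyP => j; case: (ltnP j k) => [lt_jk|le_kj].
  exact: (pq (Ordinal lt_jk)).
by rewrite !nth_default // (leq_trans _ le_kj).
Qed.

Lemma size_sum_le (I : finType) (F : I -> {poly R}) d :
  (forall i, (size (F i) <= d)%N) -> (size (\sum_i F i)%R <= d)%N.
Proof.
move=> le_d; apply: (big_ind (fun p : {poly R} => size p <= d)%N) => //.
  by rewrite size_poly0.
by move=> p q sp sq; apply: leq_trans (size_polyD _ _) _; rewrite geq_max sp.
Qed.

Lemma size_spread d (y : 'I_d -> R) : (size (\sum_j y j *: 'X^j)%R <= d)%N.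
Proof.
apply: size_sum_le => j; apply: leq_trans (size_scale_leq _ _) _.
by rewrite size_polyXn.
Qed.

(** Multiplying by the matrix amounts to substituting the polynomials with the
given coefficients into the left-hand sides of the equations. *)
Lemma mul_sysmxP x (e : 'I_n -> {poly R}) : (forall i, (size (e i) <= k)%N) ->
  uvec x *m sysmx = \row_c (let q : equation := enum_val c in (e q.1)`_q.2) <->
  (forall i, a i *: gpart x - b i *: fpart x - lform i ^+ m i * wpart x i = e i).
Proof.
move=> se; split=> [/rowP eqe i|eqe]; last first.
  by apply/rowP => c; rewrite mul_uvec_sysmx /= sum_column eqe mxE.
rewrite -sum_column; apply: polyP_lt => //.
  apply: size_sum_le => u; apply: leq_trans (size_scale_leq _ _) _.
  exact: size_column.
move=> j; have := eqe (enum_rank (i, j)).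
by rewrite mul_uvec_sysmx mxE /= enum_rankK.
Qed.

Lemma mul_sysmx0P x : uvec x *m sysmx = 0 <->
  (forall i, a i *: gpart x - b i *: fpart x = lform i ^+ m i * wpart x i).
Proof.
pose e0 (i : 'I_n) : {poly R} := 0.
have: forall i, (size (e0 i) <= k)%N by move=> i; rewrite size_poly0.
move/(mul_sysmxP x).
have -> : \row_(c < #|equation|) (let q : equation := enum_val c in (e0 q.1)`_q.2) = 0.
  by apply/rowP => c; rewrite !mxE /= coef0.
by move=> ->; split=> eqs i; apply/eqP; [rewrite -subr_eq0 eqs | rewrite subr_eq0 eqs].
Qed.

Lemma coef_spread d (y : 'I_d -> R) (j : 'I_d) : (\sum_j y j *: 'X^j)`_j = y j.
Proof.
rewrite coef_sum (bigD1 j) //= coefZ coefXn eqxx mulr1 big1 ?addr0 // => i ne_ij.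
by rewrite coefZ coefXn eq_sym (inj_eq val_inj) (negbTE ne_ij) mulr0.
Qed.

Lemma spread_coef d (p : {poly R}) : (size p <= d)%N ->
  \sum_(j < d) p`_j *: 'X^j = p.
Proof.
move=> sp; rewrite -poly_def; apply/polyP => i; rewrite coef_poly.
by case: ltnP => // le_di; rewrite nth_default // (leq_trans sp).
Qed.

End Ring.

End System.

Section Solutions.
Variables (n k : nat) (m : 'I_n -> nat).

(** Homogeneous coordinates (a_i, b_i) are kept, over an arbitrary ring, because
the system is used with points at infinity, with points depending on a
parameter, and with indeterminate coordinates. *)
Definition solves (R : comNzRingType) (a b : 'I_n -> R) (f g : {poly R}) :=
  [/\ (size f <= k)%N, (size g <= k)%N & forall i, exists2 w : {poly R},
      (size w <= k - m i)%N & a i *: g - b i *: f = lform a b i ^+ m i * w].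

Hypothesis le_mk : forall i, (m i <= k)%N.
Hypothesis sum_m : (\sum_i m i = k.*2)%N.

Definition unknown_of (R : comNzRingType) (f g : {poly R})
    (w : 'I_n -> {poly R}) (u : unknown k m) : R :=
  match u with
  | inl (inl j) => f`_j
  | inl (inr j) => g`_j
  | inr (existT i j) => (w i)`_j
  end.

Lemma lform_eq0 (R : comNzRingType) (a b : 'I_n -> R) i :
  (lform a b i == 0) = (a i == 0) && (b i == 0).
Proof.
apply/eqP/andP => [l0|[/eqP a0 /eqP b0]]; last by rewrite /lform a0 b0 scale0r subrr.
move/polyP: l0 => l0; move: (l0 0%N) (l0 1%N); rewrite !coef0.
rewrite !coefB !coefZ !coefX !coefC /= mulr0 mulr1 sub0r subr0.
by move=> /eqP; rewrite oppr_eq0 => -> ->.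
Qed.

Lemma solves_det0 (R : idomainType) (a b : 'I_n -> R) (f g : {poly R}) :
  solves a b f g -> (f != 0) || (g != 0) -> \det (sysmx le_mk sum_m a b) = 0.
Proof.
case=> sf sg solfg nz; apply/eqP/det0P.
have /fin_all_exists2 [w sw eqw] := solfg.
exists (uvec le_mk sum_m (unknown_of f g w)); last first.
  by apply/mul_sysmx0P => i; rewrite /fpart /gpart /wpart /= !spread_coef.
apply: contraL nz => /eqP v0; rewrite negb_or !negbK.
have x0 u : unknown_of f g w u = 0.
  move/rowP: v0 => /(_ (cast_ord (esym (card_unknown le_mk sum_m)) (enum_rank u))).
  by rewrite !mxE cast_ordKV enum_rankK.
by apply/andP; split; apply/eqP; [have s := sf | have s := sg];
  apply: (polyP_lt s); rewrite ?size_poly0 // => j; rewrite coef0;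
  [exact: (x0 (inl (inl j))) | exact: (x0 (inl (inr j)))].
Qed.

Lemma spread_eq0 (R : comNzRingType) d (y : 'I_d -> R) :
  \sum_j y j *: 'X^j = 0 -> forall j, y j = 0.
Proof. by move=> y0 j; rewrite -(coef_spread y) y0 coef0. Qed.

(** The quotients w_i are determined by f and g, as a_i X - b_i is nonzero. *)
Lemma parts_eq0 (R : idomainType) (a b : 'I_n -> R) (x : unknown k m -> R) :
  (forall i, (a i != 0) || (b i != 0)) ->
  uvec le_mk sum_m x *m sysmx le_mk sum_m a b = 0 ->
  fpart x = 0 -> gpart x = 0 -> forall u, x u = 0.
Proof.
move=> nz /mul_sysmx0P sol f0 g0 [[j|j]|[i j]].
- exact: (spread_eq0 f0).
- exact: (spread_eq0 g0).
have w0 : wpart x i = 0; last exact: (spread_eq0 w0).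
apply/eqP; have /esym/eqP := sol i.
rewrite f0 g0 !scaler0 subrr mulf_eq0 expf_eq0 lform_eq0.
by rewrite (negbTE (_ : ~~ ((a i == 0) && (b i == 0)))) ?andbF // negb_and nz.
Qed.

Lemma parts_solve (R : comNzRingType) (a b : 'I_n -> R) (x : unknown k m -> R) :
  uvec le_mk sum_m x *m sysmx le_mk sum_m a b = 0 -> solves a b (fpart x) (gpart x).
Proof.
move/mul_sysmx0P => sol; split; try exact: size_spread.
by move=> i; exists (wpart x i); [exact: size_spread | exact: sol].
Qed.

Lemma no_solution_det (R : idomainType) (a b : 'I_n -> R) :
  (forall i, (a i != 0) || (b i != 0)) ->
  (forall f g, solves a b f g -> f = 0 /\ g = 0) ->
  \det (sysmx le_mk sum_m a b) != 0.
Proof.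
move=> nz nosol; apply/negP => /det0P [v nz_v v0]; case/negP: nz_v.
apply/eqP; apply: (uncoef_inj (le_mk := le_mk) (sum_m := sum_m)).
rewrite -(uvecK le_mk sum_m v) in v0.
have [f0 g0] := nosol _ _ (parts_solve v0).
exact: parts_eq0 v0 f0 g0.
Qed.

(** Injectivity of the square system gives the solvability of all inhomogeneous
systems; this replaces every dimension count. *)
Lemma det_surjective (K : fieldType) (a b : 'I_n -> K) (e : 'I_n -> {poly K}) :
  \det (sysmx le_mk sum_m a b) != 0 -> (forall i, (size (e i) <= k)%N) ->
  exists f g : {poly K}, [/\ (size f <= k)%N, (size g <= k)%N &
    forall i, exists2 w : {poly K}, (size w <= k - m i)%N &
       a i *: g - b i *: f - lform a b i ^+ m i * w = e i].
Proof.
move=> det_nz se; set M := sysmx _ _ _ _ in det_nz.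
have uM : M \in unitmx by rewrite unitmxE unitfE.
pose v := (\row_c (let q : equation n k := enum_val c in (e q.1)`_q.2)) *m invmx M.
have := uvecK le_mk sum_m v; set x := uncoef _ _ _ => vE.
have : uvec le_mk sum_m x *m M =
    \row_c (let q : equation n k := enum_val c in (e q.1)`_q.2).
  by rewrite vE mulmxKV.
move/(mul_sysmxP _ _ _ _ _ se) => sol.
exists (fpart x), (gpart x); split; try exact: size_spread.
by move=> i; exists (wpart x i); [exact: size_spread | exact: sol].
Qed.

Lemma map_lform (R R' : comNzRingType) (phi : {rmorphism R -> R'})
    (a b : 'I_n -> R) i :
  map_poly phi (lform a b i) = lform (phi \o a) (phi \o b) i.
Proof. by rewrite /lform rmorphB /= map_polyZ map_polyX map_polyC. Qed.

Lemma map_sysmx (R R' : comNzRingType) (phi : {rmorphism R -> R'})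
    (a b : 'I_n -> R) :
  map_mx phi (sysmx le_mk sum_m a b) = sysmx le_mk sum_m (phi \o a) (phi \o b).
Proof.
apply/matrixP => r c; rewrite !mxE /= -coef_map /=; congr (_`_ _).
case: (enum_val _) => [[j|j]|[i j]] /=.
- by rewrite map_polyZ rmorphN map_polyXn.
- by rewrite map_polyZ map_polyXn.
case: ifP => _; last by rewrite rmorph0.
by rewrite rmorphM rmorphN rmorphXn /= map_polyXn map_lform.
Qed.

End Solutions.

(** * Degenerating a family of systems *)

Section Degeneration.
Variables (n k : nat) (m : 'I_n -> nat).
Hypothesis le_mk : forall i, (m i <= k)%N.
Hypothesis sum_m : (\sum_i m i = k.*2)%N.
Variable K : numFieldType.

Lemma poly_nonroots0 (p : {poly K}) (bad : {poly K}) : bad != 0 ->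
  (forall e, ~~ root bad e -> p.[e] = 0) -> p = 0.
Proof.
move=> nz_bad p0; apply/eqP; apply: contraT => nz_p.
have nz : p * bad != 0 by rewrite mulf_neq0.
have := max_poly_roots nz (rs := [seq i%:R | i <- iota 0 (size (p * bad))]).
rewrite size_map size_iota ltnn; apply.
  apply/allP => e _; rewrite rootM; case: (boolP (root bad e)) => [_|/p0/rootP->//].
  by rewrite orbT.
by rewrite map_inj_uniq ?iota_uniq // => i j /eqP; rewrite eqr_nat => /eqP.
Qed.

(** The outer indeterminate is that of f and g; the inner one is the parameter of
the family. *)
Definition at0 (p : {poly {poly K}}) : {poly K} := map_poly (horner_eval 0) p.

Lemma divXrow N (v : 'rV[{poly K}]_N) : v != 0 ->
  exists (d : nat) (u : 'rV[{poly K}]_N), v = 'X^d *: u /\ exists i, (u 0 i).[0] != 0.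
Proof.
move=> nz_v.
have [s le_s] : exists s, forall i, (size (v 0%R i) <= s)%N.
  by exists (\max_i size (v 0%R i))%N => i; apply: leq_bigmax.
elim: s v nz_v le_s => [|s IHs] v nz_v le_s.
  case/eqP: nz_v; apply/rowP => i; apply/eqP; rewrite mxE -size_poly_leq0; exact: le_s.
case: (boolP [exists i, (v 0%R i).[0] != 0]) => [/existsP ex|].
  by exists 0, v; rewrite expr0 scale1r.
rewrite negb_exists => /forallP v00.
pose v' := \row_i (v 0%R i %/ 'X).
have vE : v = 'X *: v'.
  apply/rowP => i; rewrite !mxE mulrC divpK //.
  by have := v00 i; rewrite negbK -[_ == 0]/(root _ _) -dvdp_XsubCl subr0.
have nz_v' : v' != 0 by apply: contraNneq nz_v => v'0; rewrite vE v'0 scaler0.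
have [|d [u [v'E exu]]] := IHs v' nz_v'.
  move=> i; have := le_s i; rewrite vE mxE mulrC.
  case: (eqVneq (v' 0 i) 0) => [->|nz]; first by rewrite size_poly0.
  by rewrite size_mulX.
by exists d.+1, u; rewrite exprS -scalerA -v'E.
Qed.

(** The determinant vanishes identically as a polynomial in the parameter, so the
system has a nonzero polynomial solution; dividing it by the largest possible
power of the parameter makes its value at 0 nonzero.  The hypothesis on the
coordinates at 0 excludes a solution with f = g = 0 there. *)
Theorem degeneration (a b : 'I_n -> {poly K}) (bad : {poly K}) :
  (forall i, ((a i).[0] != 0) || ((b i).[0] != 0)) -> bad != 0 ->
  (forall e, ~~ root bad e -> exists f g,
     solves k m (fun i => (a i).[e]) (fun i => (b i).[e]) f g /\ (f != 0) || (g != 0)) ->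
  exists F G, solves k m a b F G /\ (at0 F != 0) || (at0 G != 0).
Proof.
move=> nz0 nz_bad sol; pose M := sysmx le_mk sum_m a b.
have detM e : (\det M).[e] =
    \det (sysmx le_mk sum_m (fun i => (a i).[e]) (fun i => (b i).[e])).
  rewrite -[LHS]/(horner_eval e _) -det_map_mx map_sysmx //.
have /eqP/det0P [v0 nz_v0 v0M] : \det M = 0.
  apply: (poly_nonroots0 nz_bad) => e /sol [f [g [fg nz]]].
  by rewrite detM; apply: solves_det0 fg nz.
have [d [v [v0E [r nz_r]]]] := divXrow nz_v0.
have vM : v *m M = 0.
  apply/eqP; move/eqP: v0M; rewrite v0E -scalemxAl scalemx_eq0.
  by rewrite (negbTE (expf_neq0 _ (negbT (polyX_eq0 _)))).
have := uvecK le_mk sum_m v; set x := uncoef _ _ _ => vE.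
rewrite -vE in vM; exists (fpart x), (gpart x); split.
  exact: parts_solve vM.
apply: contraT; rewrite negb_or !negbK => /andP[/eqP F0 /eqP G0].
pose x0 u := horner_eval 0 (x u).
have x00 : forall u, x0 u = 0.
  apply: (@parts_eq0 _ _ _ le_mk sum_m K (fun i => (a i).[0]) (fun i => (b i).[0])) => //.
  - have -> : uvec le_mk sum_m x0 = map_mx (horner_eval 0) (uvec le_mk sum_m x).
      by apply/rowP => c; rewrite !mxE.
    have -> : sysmx le_mk sum_m (fun i => (a i).[0]) (fun i => (b i).[0]) =
        map_mx (horner_eval 0) M.
      by rewrite map_sysmx.
    by rewrite -map_mxM vM map_mx0.
  - rewrite -F0 /at0 raddf_sum; apply: eq_bigr => j _; by rewrite /= map_polyZ map_polyXn.
  rewrite -G0 /at0 raddf_sum; apply: eq_bigr => j _; by rewrite /= map_polyZ map_polyXn.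
case/eqP: nz_r; rewrite -vE mxE; exact: x00.
Qed.

End Degeneration.

(** * Rigid configurations of affine points *)

Lemma lform_affine (R : comNzRingType) n (b : 'I_n -> R) i :
  lform (fun=> 1) b i = 'X - (b i)%:P.
Proof. by rewrite /lform scale1r. Qed.

Section Univariate.
Variable K : numFieldType.
Implicit Types (f g u v w p : {poly K}) (s : seq (K * nat)) (t q : K).

(** A configuration is a list of pairs (t, m): the line y = t x with multiplicity
m.  Lists suit the induction, which permutes, merges and removes points, better
than families indexed by ordinals. *)
Definition tangent s f g :=
  all (fun x => ('X - x.1%:P) ^+ x.2 %| g - x.1 *: f) s.

Definition rigid k s := forall f g, (size f <= k)%N -> (size g <= k)%N ->
  tangent s f g -> f = 0 /\ g = 0.

Lemma quotient_size (l k : nat) t p w : p = ('X - t%:P) ^+ l * w ->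
  (size p <= k)%N -> (size w <= k - l)%N.
Proof.
move=> -> ; case: (eqVneq w 0) => [->|nz]; first by rewrite size_poly0.
rewrite size_monicM ?monic_exp ?monicXsubC // size_exp_XsubC => le.
by rewrite leq_subRL; lia.
Qed.

Lemma solves_tangent n k (m : 'I_n -> nat) (b : 'I_n -> K) f g :
  solves k m (fun=> 1) b f g <->
  [/\ (size f <= k)%N, (size g <= k)%N &
      forall i, ('X - (b i)%:P) ^+ m i %| g - b i *: f].
Proof.
split=> [[sf sg sol]|[sf sg sol]]; split=> // i.
  have [w _] := sol i; rewrite lform_affine scale1r => ->.
  by rewrite dvdp_mulr.
case/dvdpP: (sol i) => w; rewrite mulrC => wE.
exists w; last by rewrite lform_affine scale1r.
apply: quotient_size wE _.
rewrite (leq_trans (size_polyD _ _)) // geq_max sg size_polyN.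
exact: leq_trans (size_scale_leq _ _) sf.
Qed.

Definition specialize (e : K) (L : seq ({poly K} * nat)) : seq (K * nat) :=
  [seq (x.1.[e], x.2) | x <- L].

Lemma family_degeneration (L : seq ({poly K} * nat)) k (bad : {poly K}) :
  all (fun x => x.2 <= k)%N L -> sumn (map snd L) = k.*2 -> bad != 0 ->
  (forall e, ~~ root bad e -> ~ rigid k (specialize e L)) ->
  exists F G : {poly {poly K}},
   [/\ (size F <= k)%N /\ (size G <= k)%N,
       forall x, x \in L -> exists W, G - x.1 *: F = ('X - x.1%:P) ^+ x.2 * W
     & (at0 F != 0) || (at0 G != 0)].
Proof.
move=> /allP le_k sum_L nz_bad sol.
pose n := size L; pose b (i : 'I_n) := (nth (0, 0%N) L i).1.
pose m (i : 'I_n) := (nth (0, 0%N) L i).2.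
have le_mk i : (m i <= k)%N by apply: le_k; rewrite mem_nth.
have sum_m : (\sum_i m i = k.*2)%N.
  by rewrite -sum_L sumnE big_map (big_nth (0, 0%N)) big_mkord.
have [//||F [G [[sF sG solFG] nz]]] := degeneration le_mk sum_m (a := fun=> 1) (b := b) _ nz_bad.
- by move=> i; rewrite hornerC oner_eq0.
- move=> e /sol nrig; apply: contrapT => nsol; apply: nrig => f g sf sg tan.
  apply: contrapT => nz; case: nsol; exists f, g; split; last first.
    apply: contraT; rewrite negb_or !negbK => /andP[/eqP f0 /eqP g0].
    by case: nz.
  have -> : (fun i : 'I_n => (1 : {poly K}).[e]) = (fun=> 1).
    by apply: funext => i; rewrite hornerC.
  apply/solves_tangent; split=> // i.
  move/allP: tan => /(_ ((b i).[e], m i)); apply.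
  by apply/mapP; exists (nth (0, 0%N) L i) => //; rewrite mem_nth.
exists F, G; split=> // x /(nthP (0, 0%N)) [i lt_i <-].
have [W _] := solFG (Ordinal lt_i); rewrite lform_affine scale1r /b /m /= => WE.
by exists W.
Qed.

End Univariate.

(** * Collision of two points *)

Section Collision.
Variable K : numFieldType.
Implicit Types (f g u v w p : {poly K}) (s : seq (K * nat)) (t q : K).

HB.instance Definition _ := GRing.RMorphism.copy (@at0 K) (map_poly (horner_eval 0)).

Lemma at0_X : at0 ('X : {poly {poly K}}) = 'X.
Proof. exact: map_polyX. Qed.

Lemma at0_C (c : {poly K}) : at0 c%:P = (c.[0])%:P.
Proof. exact: map_polyC. Qed.

Lemma at0_Z (c : {poly K}) P : at0 (c *: P) = c.[0] *: at0 P.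
Proof. exact: map_polyZ. Qed.

Lemma at0_B (P Q : {poly {poly K}}) : at0 (P - Q) = at0 P - at0 Q.
Proof. exact: rmorphB. Qed.

Lemma at0_M (P Q : {poly {poly K}}) : at0 (P * Q) = at0 P * at0 Q.
Proof. exact: rmorphM. Qed.

Lemma at0_exp (P : {poly {poly K}}) d : at0 (P ^+ d) = at0 P ^+ d.
Proof. exact: rmorphXn. Qed.

Lemma size_at0 k (P : {poly {poly K}}) : (size P <= k)%N -> (size (at0 P) <= k)%N.
Proof. by apply: leq_trans; apply: size_poly. Qed.

Lemma at0_eq0 (P : {poly {poly K}}) : at0 P = 0 -> exists Q, P = 'X%:P * Q.
Proof.
move=> P0; exists (map_poly (fun c => c %/ 'X) P).
apply/polyP => i; rewrite coefCM coef_map_id0 ?div0p // mulrC divpK //.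
move/polyP/(_ i): P0; rewrite coef_map /= coef0 => /eqP.
by rewrite /horner_eval -[_ == 0]/(root _ _) -dvdp_XsubCl subr0.
Qed.

(** Write T = X - q, and let U and V be the quotients of the tangency conditions
at q and at q + eps, of orders d + l + 1 and l + 1.  The difference of the two
conditions expresses eps F through U and V; its reduction modulo eps gives
V = T^d U + eps V_1, and then eps can be cancelled.  The first-order term of
(T - eps)^(l+1) contributes the factor l + 1. *)
Lemma collision s q d l k :
  (d + l.+1 <= k)%N -> all (fun x => x.2 <= k)%N s ->
  (d + l.+1 + (l.+1 + sumn (map snd s)) = k.*2)%N -> q \notin map fst s ->
  (forall e, e != 0 -> q + e \notin map fst s ->
     ~ rigid k ((q, (d + l.+1)%N) :: (q + e, l.+1) :: s)) ->
  exists f g u v,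
   [/\ (size f <= k)%N /\ (size g <= k)%N, tangent s f g,
       g - q *: f = ('X - q%:P) ^+ (d + l.+1) * u,
       f = ('X - q%:P) ^+ (d + l) * (l.+1%:R *: u) - ('X - q%:P) ^+ l.+1 * v
     & (f != 0) || (g != 0)].
Proof.
move=> le_dl /allP le_s sum_s q_s flex.
pose L := (q%:P, (d + l.+1)%N) :: (q%:P + 'X, l.+1) :: [seq (x.1%:P, x.2) | x <- s].
pose bad := 'X * \prod_(z <- [seq x.1 - q | x <- s]) ('X - z%:P).
have nz_bad : bad != 0.
  by rewrite mulf_neq0 ?polyX_eq0 // monic_neq0 ?monic_prod_XsubC.
have [||e|F [G [[sF sG] solFG nz]]] := @family_degeneration _ L k bad _ _ nz_bad.
- apply/allP => x; rewrite !inE => /orP[/eqP->//|/orP[/eqP->/=|/mapP[y ys ->]]].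
    by rewrite (leq_trans _ le_dl) ?leq_addl.
  exact: le_s.
- by rewrite /= -map_comp.
- rewrite rootM negb_or rootE hornerX => /andP[nz_e nr_e].
  have -> : specialize e L = (q, (d + l.+1)%N) :: (q + e, l.+1) :: s.
    rewrite /specialize /L /= hornerC hornerD hornerC hornerX -map_comp.
    by rewrite map_id_in // => -[x1 x2] _ /=; rewrite hornerC.
  apply: flex => //; apply: contra nr_e => /mapP[x xs eqx].
  by rewrite root_prod_XsubC; apply/mapP; exists x => //; rewrite -eqx addrC addKr.
have [U EU] := solFG (q%:P, (d + l.+1)%N) (mem_head _ _).
have [V EV] := solFG (q%:P + 'X, l.+1) (mem_behead (s := L) (mem_head _ _)).
rewrite /= in EU EV.
pose S : {poly {poly K}} := 'X - q%:P%:P; pose eps : {poly {poly K}} := 'X%:P.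
have eqS : 'X - (q%:P + 'X)%:P = S - eps :> {poly {poly K}} by rewrite polyCD opprD addrA.
rewrite eqS in EV; rewrite -/S in EU.
have E : eps * F = S ^+ (d + l.+1) * U - (S - eps) ^+ l.+1 * V.
  by rewrite -EU -EV -!mul_polyC polyCD /eps; ring.
pose T := 'X - q%:P : {poly K}.
have at0S : at0 S = T by rewrite rmorphB /= at0_X at0_C hornerC.
have at0e : at0 eps = 0 by rewrite at0_C hornerX.
have at0Se : at0 (S - eps) = T by rewrite [LHS]rmorphB /= at0S at0e subr0.
have T_nz j : T ^+ j != 0 by rewrite expf_neq0 // polyXsubC_eq0.
(* The difference of the two conditions, at eps = 0. *)
have V0 : at0 V = T ^+ d * at0 U.
  move/(congr1 (@at0 K)): E; rewrite rmorphM rmorphB /= !rmorphM !rmorphXn /=.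
  rewrite at0e at0S at0Se mul0r => /esym/eqP; rewrite subr_eq0 addnC exprD -mulrA.
  by move/eqP/(mulfI (T_nz _)).
have [V1 EV1] : exists V1, V - S ^+ d * U = eps * V1.
  by apply: at0_eq0; rewrite rmorphB rmorphM rmorphXn /= at0S V0 subrr.
pose Q := \sum_(i < l.+1) S ^+ (l.+1.-1 - i) * (S - eps) ^+ i.
have EQ : S ^+ l.+1 - (S - eps) ^+ l.+1 = eps * Q.
  by rewrite subrXX opprB addrC subrK.
have Q0 : at0 Q = l.+1%:R *: T ^+ l.
  rewrite rmorph_sum /= (eq_bigr (fun=> T ^+ l)); last first.
    move=> i _; rewrite rmorphM !rmorphXn /= at0S at0Se -exprD subnK //.
    by rewrite -ltnS.
  by rewrite sumr_const card_ord scaler_nat.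
have nz_eps : eps != 0 by rewrite polyC_eq0 polyX_eq0.
(* The difference again, now divided by eps. *)
have FE : F = S ^+ d * U * Q - (S - eps) ^+ l.+1 * V1.
  apply: (mulfI nz_eps); rewrite E mulrBr mulrCA -EQ mulrCA -EV1 exprD.
  by ring.
exists (at0 F), (at0 G), (at0 U), (at0 V1); split=> //.
- by split; apply: size_at0.
- apply/allP => x xs.
  have [|W EW] := solFG (x.1%:P, x.2).
    by rewrite !inE; apply/orP; right; apply/orP; right; apply/mapP; exists x.
  move/(congr1 (@at0 K)): EW; rewrite rmorphM rmorphXn !rmorphB /=.
  by rewrite at0_X at0_C at0_Z !hornerC => ->; rewrite dvdp_mulr.
- move/(congr1 (@at0 K)): EU; rewrite rmorphM rmorphXn !rmorphB /=.
  by rewrite at0_X at0_C at0_Z !hornerC.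
- rewrite FE rmorphB !rmorphM !rmorphXn /= Q0 at0S at0Se.
  by rewrite exprD -!scalerAr -!mulrA [at0 U * _]mulrC.
Qed.

End Collision.

(** * Merging points, and configurations of two or three points *)

Section Merging.
Variable K : numFieldType.
Implicit Types (f g u v w p : {poly K}) (s : seq (K * nat)) (t q : K) (m : seq nat).

Definition has_rigid_points m := exists s : seq (K * nat),
  [/\ map snd s = m, uniq (map fst s) & rigid (sumn m)./2 s].

(** Away from q, the factor (X - q)^j is prime to the divisors X - t. *)
Lemma tangent_cancel s q j f g : q \notin map fst s ->
  tangent s (('X - q%:P) ^+ j * f) (('X - q%:P) ^+ j * g) -> tangent s f g.
Proof.
move=> q_s /allP tan; apply/allP => x xs; move: (tan x xs).
rewrite scalerAr -mulrBr Gauss_dvdpr //.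
apply/coprimep_expl/coprimep_expr/coprimep_XsubC2.
by rewrite subr_eq0; apply: contraNneq q_s => ->; apply: map_f.
Qed.

(** For d + 1 > 0 both components of the limit of a collision are divisible by
(X - q)^(l+1), and the quotient is a solution for one point of multiplicity
d + 1, hence zero. *)
Lemma rigid_points_merge d l m k : (d.+1 + l.+1 <= k)%N -> all (fun x => x <= k)%N m ->
  (d.+1 + l.+1 + (l.+1 + sumn m) = k.*2)%N ->
  has_rigid_points (d.+1 :: m) -> has_rigid_points [:: (d.+1 + l.+1)%N, l.+1 & m].
Proof.
move=> le_dl le_m sum_m; rewrite {1}/has_rigid_points.
have -> : ((sumn (d.+1 :: m))./2 = k - l.+1)%N by rewrite [sumn _]/=; lia.
case=> s0 []; case: s0 => [|[q d'] s]; first by [].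
move=> /= [-> snd_s] /andP[q_s uniq_s].
move=> rig; apply: contrapT => nbal.
have [|||||f [g [u [v [[sf sg] tan gE fE]]]]] := @collision _ s q d.+1 l k => //.
- by move: le_m; rewrite -snd_s all_map.
- by rewrite snd_s.
- move=> e nz_e e_s rig'; case: nbal.
  exists [:: (q, (d.+1 + l.+1)%N), (q + e, l.+1) & s]; split; first by rewrite /= snd_s.
    rewrite /= inE negb_or q_s uniq_s e_s !andbT eq_sym -subr_eq0 addrC addKr nz_e //.
  suff -> : ((sumn [:: (d.+1 + l.+1)%N, l.+1 & m])./2 = k)%N by [].
  by rewrite [sumn _]/= sum_m doubleK.
pose T := 'X - q%:P : {poly K}.
pose f' := T ^+ d * (l.+1%:R *: u) - v; pose g' := q *: f' + T ^+ d.+1 * u.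
have fE' : f = T ^+ l.+1 * f'.
  by rewrite fE mulrBr mulrA -exprD addSnnS addnC.
have gE' : g = T ^+ l.+1 * g'.
  apply/eqP; rewrite -subr_eq0 mulrDr mulrA -exprD -scalerAr -fE' opprD addrA gE.
  by rewrite addnC subrr.
have [|||f0 g0] := rig f' g'.
- exact: quotient_size fE' sf.
- exact: quotient_size gE' sg.
- apply/andP; split => /=; first by rewrite /g' [_ + T ^+ _ * u]addrC addrK dvdp_mulr.
  by rewrite fE' gE' in tan; apply: tangent_cancel tan.
by rewrite fE' gE' f0 g0 !mulr0 eqxx.
Qed.

Lemma rigid_points_perm m m' : perm_eq m m' -> has_rigid_points m -> has_rigid_points m'.
Proof.
move=> pm [s [snd_s uniq_s rig]].
have [s' ps snd_s'] : exists2 s', perm_eq s s' & map snd s' = m'.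
  have /(perm_iotaP 0%N) [I pI m'E] : perm_eq m' (map snd s) by rewrite snd_s perm_sym.
  exists (map (nth (0, 0%N) s) I).
    rewrite size_map in pI; rewrite perm_sym (perm_trans (perm_map _ pI)) //.
    by rewrite map_nth_iota0 // take_size.
  rewrite m'E -map_comp; apply/eq_in_map => i.
  rewrite (perm_mem pI) mem_iota size_map => /andP[_ lt_i].
  by rewrite (nth_map (0, 0%N)).
exists s'; split=> //.
  by rewrite -(perm_uniq (perm_map _ ps)).
move=> f g sf sg tan; apply: rig => //.
- by rewrite (perm_sumn pm).
- by rewrite (perm_sumn pm).
by rewrite /tangent (perm_all _ ps).
Qed.

Lemma rigid_points2 k : (0 < k)%N -> has_rigid_points [:: k; k].
Proof.
move=> k_gt0; exists [:: (0, k); (1, k)]; split=> //=.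
  by rewrite inE eq_sym oner_eq0.
rewrite addn0 addnn doubleK => f g sf sg /and3P[/= d0 d1 _].
have small q : ('X - q%:P) ^+ k %| g - q *: f -> g = q *: f.
  move=> dv; apply/eqP; rewrite -subr_eq0; apply: contraTT dv => nz.
  apply/negP => /(dvdp_leq nz); rewrite size_exp_XsubC leqNgt ltnS.
  rewrite (leq_trans (size_polyD _ _)) // geq_max sg size_polyN.
  by rewrite (leq_trans (size_scale_leq _ _)).
have g0 := small _ d0; have := small _ d1.
by rewrite scale1r g0 scale0r => <-.
Qed.

Lemma dvdp_deriv t j p : ('X - t%:P) ^+ j.+1 %| p -> ('X - t%:P) ^+ j %| p^`().
Proof.
case/dvdpP => w ->; rewrite derivM deriv_exp derivXsubC mul1r /=.
rewrite dvdp_add // ?dvdp_mull // ?exprS ?dvdp_mull //.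
by rewrite -mulr_natr dvdp_mulr.
Qed.

Lemma dvdp_small d p : d %| p -> (size p < size d)%N -> p = 0.
Proof.
move=> dv lt_p; apply/eqP; apply: contraTT lt_p => nz.
by rewrite -leqNgt (dvdp_leq nz).
Qed.

(** Only the exponents in [0, a) and in [l, l + b) occur in X^l u - f, and in
characteristic 0 a nonzero polynomial with at most j terms cannot vanish to
order j at 1.  Differentiation lowers a by one. *)
Lemma sparse_vanishing a b l j f u : (a <= l)%N -> (a + b <= j)%N ->
  (size f <= a)%N -> (size u <= b)%N -> ('X - 1%:P) ^+ j %| 'X^l * u - f ->
  f = 0 /\ u = 0.
Proof.
elim: a l j f u => [|a IHa] l j f u le_al le_j sf su dv.
  move: sf; rewrite size_poly_leq0 => /eqP f0; split=> //.
  move: dv; rewrite f0 subr0 Gauss_dvdpr => [dv|]; last first.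
    apply/coprimep_expl/coprimep_expr.
    have := @coprimep_XsubC2 K 1 0; rewrite subr0; apply.
    by rewrite sub0r oppr_eq0 oner_eq0.
  by apply: (dvdp_small (d := ('X - 1%:P) ^+ j)) => //; rewrite size_exp_XsubC ltnS (leq_trans su).
case: l le_al dv => // l le_al; case: j le_j => // j le_j dv.
have sder p : (size p^`() <= (size p).-1)%N.
  case: (eqVneq p 0) => [->|nz]; first by rewrite deriv0 size_poly0.
  by have := lt_size_deriv nz; lia.
have derE : ('X^(l.+1) * u - f)^`() = 'X^l * (l.+1%:R *: u + 'X * u^`()) - f^`().
  rewrite derivB derivM derivXn mulrDr exprS -scaler_nat -!mul_polyC polyC_natr.
  by rewrite /=; ring.
have [|||||f0 u0] := IHa l j f^`() (l.+1%:R *: u + 'X * u^`()) => //.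
- by have := sder f; lia.
- apply: leq_trans (size_polyD _ _) _; rewrite geq_max; apply/andP; split.
    exact: leq_trans (size_scale_leq _ _) su.
  case: (eqVneq u 0) su => [->|nz] su; first by rewrite deriv0 mulr0 size_poly0.
  apply: leq_trans (size_polyMleq _ _) _; rewrite size_polyX /=.
  exact: leq_trans (lt_size_deriv nz) su.
- by rewrite -derE; apply: dvdp_deriv.
have u_eq0 : u = 0.
  apply/polyP => i; rewrite coef0; apply/eqP.
  have /eqP := congr1 (fun p : {poly K} => p`_i) u0.
  rewrite coefD coefZ coefXM coef_deriv coef0.
  case: i => [|i] /=; first by rewrite addr0 mulf_eq0 pnatr_eq0.
  by rewrite -[X in _ + X]mulr_natl -mulrDl -natrD mulf_eq0 pnatr_eq0.
split=> //; apply: (dvdp_small (d := ('X - 1%:P) ^+ j.+1)).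
  by move: dv; rewrite u_eq0 mulr0 sub0r dvdpNr.
rewrite size_exp_XsubC; suff: (size f <= 1)%N by lia.
apply/leq_sizeP => i i_gt0; apply/eqP.
have /eqP := congr1 (fun p : {poly K} => p`_i.-1) f0.
by rewrite coef_deriv coef0 prednK // mulrn_eq0 (gtn_eqF i_gt0).
Qed.

End Merging.

(** The point (a_i, b_i) has the affine coordinate b_i / a_i. *)
Lemma solves_scale (K : fieldType) n k (m : 'I_n -> nat) (a b : 'I_n -> K) f g :
  (forall i, a i != 0) ->
  solves k m (fun=> 1) (fun i => b i / a i) f g <-> solves k m a b f g.
Proof.
move=> nz_a; have lE i : lform a b i = a i *: ('X - (b i / a i)%:P).
  by rewrite scalerBr -[_ *: _%:P]mul_polyC -polyCM [_ * (_ / _)]mulrC divfK.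
have eqE i : a i *: g - b i *: f = a i *: (1 *: g - (b i / a i) *: f).
  by rewrite scale1r scalerBr scalerA [_ * (_ / _)]mulrC divfK.
split=> -[sf sg sol]; split=> // i; have [w sw wE] := sol i.
  exists ((a i * (a i ^+ m i)^-1) *: w); first exact: leq_trans (size_scale_leq _ _) sw.
  rewrite eqE wE lform_affine lE exprZn -scalerAl -scalerAr !scalerA mulrCA.
  by rewrite mulfV ?mulr1 // expf_neq0.
exists ((a i ^+ m i / a i) *: w); first exact: leq_trans (size_scale_leq _ _) sw.
apply: (scalerI (nz_a i)); rewrite -eqE wE lform_affine lE exprZn -scalerAl -scalerAr scalerA.
by rewrite [a i * _]mulrC divfK.
Qed.

Section ThreePoints.
Variable K : numFieldType.

(** With the points at 0, 1 and infinity the conditions at 0 and infinity say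
that g = X^{m1} w and that f has degree less than k - m3, so that g - f has few
terms, and [sparse_vanishing] applies at 1.  The point at infinity is then
moved to a finite position by degeneration. *)
Lemma rigid_points3 k m1 m2 m3 : (m1 <= k)%N -> (m2 <= k)%N -> (m3 <= k)%N ->
  (m1 + m2 + m3 = k.*2)%N -> has_rigid_points K [:: m1; m2; m3].
Proof.
move=> le1 le2 le3 sum_m; apply: contrapT => nbal.
pose m (i : 'I_3) := nth 0%N [:: m1; m2; m3] i.
(* The third point is (e, 1), which is 1/e in the affine chart. *)
pose a (i : 'I_3) : {poly K} := nth 0 [:: 1; 1; 'X] i.
pose b (i : 'I_3) : {poly K} := nth 0 [:: 0; 1; 1] i.
have le_mk i : (m i <= k)%N by case: i => [[|[|[|//]]] lt_i].
have sum_mk : (\sum_i m i = k.*2)%N by rewrite !big_ord_recr big_ord0.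
have nz_bad : 'X * ('X - 1%:P) != 0 :> {poly K}.
  by rewrite mulf_neq0 ?polyX_eq0 ?polyXsubC_eq0.
have [||F [G [[sF sG sol] nz]]] := degeneration le_mk sum_mk (a := a) (b := b) _ nz_bad.
- by move=> [[|[|[|//]]] lt_i]; rewrite /a /b /= ?hornerC ?oner_eq0 ?orbT.
- move=> e; rewrite rootM negb_or !rootE hornerX hornerXsubC subr_eq0 => /andP[nz_e ne1].
  pose s := [:: (0 : K, m1); (1, m2); (e^-1, m3)].
  have : ~ rigid k s.
    move=> rig; apply: nbal; exists s; split=> //=.
      rewrite !inE !negb_or eq_sym oner_eq0 eq_sym invr_eq0 nz_e eq_sym.
      by rewrite -(inj_eq invr_inj) invrK invr1 ne1.
    by rewrite addn0 addnA sum_m doubleK.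
  apply: contra_notP => nsol f g sf sg tan.
  apply: contrapT => nz; apply: nsol; exists f, g; split; last first.
    apply: contraT; rewrite negb_or !negbK => /andP[/eqP f0 /eqP g0].
    by case: nz.
  apply/solves_scale; last apply/solves_tangent.
    by move=> [[|[|[|//]]] lt_i]; rewrite /a /= ?hornerC ?hornerX ?oner_eq0.
  split=> // i; case/and4P: tan => t0 t1 t2 _.
  case: i => [[|[|[|//]]] lt_i]; rewrite /a /b /m /= ?hornerC ?hornerX.
  - by rewrite mul0r.
  - by rewrite divr1.
  - by rewrite div1r.
have sol0 i : exists2 w : {poly K}, (size w <= k - m i)%N &
    (a i).[0] *: at0 G - (b i).[0] *: at0 F =
      lform (horner_eval 0 \o a) (horner_eval 0 \o b) i ^+ m i * w.
  have [W sW WE] := sol i; exists (at0 W); first exact: size_at0.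
  have := congr1 (@at0 K) WE.
  rewrite at0_B at0_M at0_exp !at0_Z => ->.
  by rewrite /at0 map_lform.
have [w1 sw1] := sol0 0; have [w2 _] := sol0 1; have [w3 sw3] := sol0 (inord 2).
rewrite /lform /a /b /m /= ?inordK //= /horner_eval !hornerC ?hornerX.
rewrite !scale0r !scale1r subr0 !sub0r polyC0 subr0 => E3 E2 E1.
rewrite /m /= in sw1; rewrite /m inordK //= in sw3.
have [|||||F0 W0] := @sparse_vanishing K (k - m3) (k - m1) m1 m2 (at0 F) w1.
- by lia.
- by lia.
- rewrite -size_polyN E3 -polyCN -rmorphXn mul_polyC.
  exact: leq_trans (size_scale_leq _ _) sw3.
- exact: sw1.
- by rewrite -E1 E2 dvdp_mulr.
by move: nz; rewrite E1 F0 W0 mulr0 eqxx.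
Qed.

End ThreePoints.

(** * Frames: solutions in the first degree where they occur *)

Section PolyFacts.
Variable K : numFieldType.
Implicit Types (p q : {poly K}).

Lemma coefM_top a b p q : (size p <= a.+1)%N -> (size q <= b.+1)%N ->
  (p * q)`_(a + b) = p`_a * q`_b.
Proof.
move=> sp sq; rewrite coefM.
have lt_a : (a < (a + b).+1)%N by rewrite ltnS leq_addr.
rewrite (bigD1 (Ordinal lt_a)) //= addKn big1 ?addr0 // => i ne_i.
case: (ltngtP i a) => [lt_i|gt_i|eq_i].
- by rewrite [q`__]nth_default ?mulr0 //; apply: leq_trans sq _; lia.
- by rewrite nth_default ?mul0r //; apply: leq_trans sp _; lia.
by case/eqP: ne_i; apply: val_inj.
Qed.

Lemma size_drop_top a p : (size p <= a.+1)%N -> p`_a = 0 -> (size p <= a)%N.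
Proof.
move=> sp pa; apply/leq_sizeP => j; rewrite leq_eqVlt => /orP[/eqP <- //|lt_j].
by rewrite nth_default // (leq_trans sp).
Qed.

Lemma prod_coprime_dvdp (I : eqType) (r : seq I) (F : I -> {poly K}) p : uniq r ->
  {in r &, forall i j, i != j -> coprimep (F i) (F j)} ->
  (forall i, i \in r -> F i %| p) -> \prod_(i <- r) F i %| p.
Proof.
elim: r => [|i r IHr] /=; first by rewrite big_nil dvd1p.
move=> /andP[ni ur] cop dv; rewrite big_cons Gauss_dvdp; last first.
  rewrite big_seq; elim/big_ind: _ => [|x y cx cy|j jr].
  - by rewrite coprimep1.
  - by rewrite coprimepMr cx.
  apply: cop; rewrite ?mem_head ?inE ?jr ?orbT //.
  by apply: contraNneq ni => ->.
rewrite dv ?mem_head // IHr //.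
  by move=> j l jr lr; apply: cop; rewrite inE ?jr ?lr orbT.
by move=> j jr; apply: dv; rewrite inE jr orbT.
Qed.

End PolyFacts.

Section Frame.
Variables (K : numFieldType) (n k : nat) (m : 'I_n -> nat) (t : 'I_n -> K).
Hypothesis le_mk : forall i, (m i <= k)%N.
Hypothesis sum_m : (\sum_i m i = k.*2)%N.
Hypothesis inj_t : injective t.
Hypothesis rig : forall f g, solves k m (fun=> 1) t f g -> f = 0 /\ g = 0.
Implicit Types f g h p : {poly K}.

Definition tangents f g := forall i, ('X - (t i)%:P) ^+ m i %| g - t i *: f.

Lemma tangentsP f g : (size f <= k)%N -> (size g <= k)%N -> tangents f g -> f = 0 /\ g = 0.
Proof. by move=> sf sg tan; apply: rig; apply/solves_tangent. Qed.

Lemma tangents_lin (c d : K) f g f' g' : tangents f g -> tangents f' g' ->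
  tangents (c *: f + d *: f') (c *: g + d *: g').
Proof.
move=> tan tan' i.
have -> : c *: g + d *: g' - t i *: (c *: f + d *: f') =
   c *: (g - t i *: f) + d *: (g' - t i *: f').
  by rewrite -!mul_polyC; ring.
by apply: dvdp_add; rewrite -mul_polyC dvdp_mull ?tan ?tan'.
Qed.

(** The leading coefficients can be prescribed: the rest of f and g solves an
inhomogeneous square system. *)
Lemma frame_exists (al be : K) : exists f g,
  [/\ (size f <= k.+1)%N /\ (size g <= k.+1)%N, tangents f g, f`_k = al & g`_k = be].
Proof.
pose c i := be - t i * al.
(* The error left in equation i once f, g and w_i are given their leading terms.
     Both products are monic of degree k, so it has degree less than k. *)
pose e i : {poly K} := c i *: (('X - (t i)%:P) ^+ m i * 'X^(k - m i) - 'X^k).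
have se i : (size (e i) <= k)%N.
  apply: leq_trans (size_scale_leq _ _) _.
  have mon : ('X - (t i)%:P) ^+ m i * 'X^(k - m i) \is monic.
    by rewrite monicMl ?monicXn // monic_exp ?monicXsubC.
  have szE : size (('X - (t i)%:P) ^+ m i * 'X^(k - m i)) = k.+1.
    rewrite size_monicM ?monic_exp ?monicXsubC ?monic_neq0 ?monicXn //.
    by rewrite size_exp_XsubC size_polyXn addnS /= addSn subnKC.
  apply: size_drop_top.
    by rewrite (leq_trans (size_polyD _ _)) // geq_max szE size_polyN size_polyXn leqnn.
  rewrite coefB coefXn eqxx -[k in _`_k]/(k.+1.-1) -szE -/(lead_coef _).
  by rewrite (monicP mon) subrr.
have det_nz : \det (sysmx le_mk sum_m (fun=> 1) t) != 0.
  by apply: no_solution_det rig => i; rewrite oner_eq0.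
have [f [g [sf sg sol]]] := det_surjective det_nz se.
have size1 (a : K) p : (size p <= k)%N -> (size (a *: 'X^k + p)%R <= k.+1)%N.
  move=> sp; apply: leq_trans (size_polyD _ _) _.
  rewrite geq_max (leq_trans (size_scale_leq _ _)) ?size_polyXn //=.
  exact: leq_trans sp (leqnSn k).
exists (al *: 'X^k + f), (be *: 'X^k + g); split.
- by split; apply: size1.
- move=> i; have [w _] := sol i; rewrite lform_affine /e scale1r => wE.
  have -> : be *: 'X^k + g - t i *: (al *: 'X^k + f) =
            ('X - (t i)%:P) ^+ m i * (w + c i *: 'X^(k - m i)).
    apply/eqP; rewrite -subr_eq0; apply/eqP.
    move: wE; set Z := _ ^+ m i; move/eqP; rewrite -subr_eq0 => /eqP <-.
    by rewrite /c -!mul_polyC polyCB polyCM; ring.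
  by rewrite dvdp_mulr.
- by rewrite coefD coefZ coefXn eqxx mulr1 nth_default ?addr0.
by rewrite coefD coefZ coefXn eqxx mulr1 nth_default ?addr0.
Qed.

Definition frame f1 g1 f2 g2 :=
  [/\ [/\ (size f1 <= k.+1)%N, (size g1 <= k.+1)%N,
           (size f2 <= k.+1)%N & (size g2 <= k.+1)%N],
      tangents f1 g1 /\ tangents f2 g2,
      f1`_k = 1 /\ g1`_k = 0 & f2`_k = 0 /\ g2`_k = 1].

Variables f1 g1 f2 g2 : {poly K}.
Hypothesis fr : frame f1 g1 f2 g2.

(** A solution of degree at most k with zero leading coefficients has degree less
than k, hence vanishes. *)
Lemma frame_span f g : (size f <= k.+1)%N -> (size g <= k.+1)%N -> tangents f g ->
  f = f`_k *: f1 + g`_k *: f2 /\ g = f`_k *: g1 + g`_k *: g2.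
Proof.
case: fr => [[sf1 sg1 sf2 sg2] [tan1 tan2] [f1k g1k] [f2k g2k]] sf sg tan.
pose f' := 1 *: f + (- 1) *: (f`_k *: f1 + g`_k *: f2).
pose g' := 1 *: g + (- 1) *: (f`_k *: g1 + g`_k *: g2).
have tan' : tangents f' g' by apply/tangents_lin/tangents_lin.
have sz (p p1 p2 : {poly K}) (a b : K) : (size p <= k.+1)%N -> (size p1 <= k.+1)%N -> 
    (size p2 <= k.+1)%N -> (size (1 *: p + (- 1) *: (a *: p1 + b *: p2))%R <= k.+1)%N.
  move=> sp sp1 sp2; apply/leq_sizeP => j le_j.
  have z (q : {poly K}) : (size q <= k.+1)%N -> q`_j = 0.
    by move=> sq; rewrite nth_default // (leq_trans sq).
  by rewrite !(coefD, coefZ) !z // !(mulr0, addr0).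
have [||f0 g0] := tangentsP _ _ tan'.
- apply: size_drop_top; first exact: sz.
  by rewrite !(coefD, coefZ) f1k f2k mulr0 addr0 mulr1 mul1r mulN1r subrr.
- apply: size_drop_top; first exact: sz.
  by rewrite !(coefD, coefZ) g1k g2k mulr0 add0r mulr1 mul1r mulN1r subrr.
by split; apply/eqP; rewrite -subr_eq0 -[X in X - _]scale1r -scaleN1r;
  apply/eqP; [exact: f0 | exact: g0].
Qed.

Definition arr_poly := \prod_i ('X - (t i)%:P) ^+ m i.

Lemma monic_arr_poly : arr_poly \is monic.
Proof. by apply: monic_prod => i _; rewrite monic_exp ?monicXsubC. Qed.

Lemma size_arr_poly : size arr_poly = k.*2.+1.
Proof.
rewrite size_prod => [|i _]; last by rewrite expf_neq0 ?polyXsubC_eq0.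
rewrite (eq_bigr (fun i => (m i) + 1)%N); last by move=> i _; rewrite size_exp_XsubC addn1.
rewrite big_split /= sum_m sum_nat_const card_ord muln1.
by lia.
Qed.

Lemma arr_poly_dvdp p : (forall i, ('X - (t i)%:P) ^+ m i %| p) -> arr_poly %| p.
Proof.
move=> dv; apply: prod_coprime_dvdp => // [|i j _ _ ne_ij]; first exact: index_enum_uniq.
apply/coprimep_expl/coprimep_expr/coprimep_XsubC2.
by rewrite subr_eq0 (inj_eq inj_t) eq_sym.
Qed.

(** Each (X - t_i)^{m_i} divides the determinant, since
f1 g2 - f2 g1 = f1 (g2 - t_i f2) - f2 (g1 - t_i f1).  Both sides are monic of
degree 2k. *)
Lemma frame_det : f1 * g2 - f2 * g1 = arr_poly.
Proof.
case: fr => [[sf1 sg1 sf2 sg2] [tan1 tan2] [f1k g1k] [f2k g2k]].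
set D := f1 * g2 - f2 * g1.
have top : D`_(k + k) = 1.
  by rewrite coefB !coefM_top // f1k g2k f2k mulr1 mul0r subr0.
have sD : (size D <= (k + k).+1)%N.
  apply/leq_sizeP => j lt_j; rewrite coefB.
  have sz0 (p q : {poly K}) : (size p <= k.+1)%N -> (size q <= k.+1)%N -> (p * q)`_j = 0.
    move=> sp sq; rewrite nth_default //; apply: leq_trans (size_polyMleq _ _) _.
    by lia.
  by rewrite !sz0 // subrr.
have sDE : size D = k.*2.+1.
  apply/eqP; rewrite -addnn eqn_leq sD ltnNge; apply/negP => le.
  by move/eqP: top; rewrite nth_default // eq_sym oner_eq0.
have dv : arr_poly %| D.
  apply: arr_poly_dvdp => i; rewrite /D.
  have -> : f1 * g2 - f2 * g1 = f1 * (g2 - t i *: f2) - f2 * (g1 - t i *: f1).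
    by rewrite -!mul_polyC; ring.
  by rewrite dvdp_sub // dvdp_mull ?tan1 ?tan2.
have monD : D \is monic.
  by rewrite monicE lead_coefE sDE /= -addnn top.
apply/eqP; rewrite eq_sym -eqp_monic ?monic_arr_poly //.
by rewrite -dvdp_size_eqp // size_arr_poly sDE.
Qed.

Definition arr_poly_off i := \prod_(j | j != i) ('X - (t j)%:P) ^+ m j.

Lemma arr_poly_offE i : arr_poly = ('X - (t i)%:P) ^+ m i * arr_poly_off i.
Proof. by rewrite /arr_poly (bigD1 i). Qed.

Lemma arr_poly_off_neq0 i : (arr_poly_off i).[t i] != 0.
Proof.
rewrite horner_prod; apply/prodf_neq0 => j ne_ji.
by rewrite horner_exp hornerXsubC expf_neq0 // subr_eq0 (inj_eq inj_t) eq_sym.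
Qed.

(** The determinant vanishes at t_i to order exactly m_i. *)
Lemma frame_local i w1 w2 : g1 - t i *: f1 = ('X - (t i)%:P) ^+ m i * w1 ->
  g2 - t i *: f2 = ('X - (t i)%:P) ^+ m i * w2 -> (f1 * w2 - f2 * w1).[t i] != 0.
Proof.
move=> E1 E2; have -> : f1 * w2 - f2 * w1 = arr_poly_off i; last exact: arr_poly_off_neq0.
apply: (mulfI (expf_neq0 (m i) (negbT (polyXsubC_eq0 (t i))))).
rewrite -arr_poly_offE -frame_det.
have -> : f1 * g2 - f2 * g1 = f1 * (g2 - t i *: f2) - f2 * (g1 - t i *: f1).
  by rewrite -!mul_polyC; ring.
by rewrite E1 E2; ring.
Qed.

End Frame.

(** * A double point on a configuration of constant multiplicity *)

(** The derivative of h and f itself are related at t: as c > 1, h vanishes there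
to order one with h'(t) = - f(t), so that c h' + (c - 1) f takes the value
- f(t).  Hence c Phi / Q, like Q' / Q, has at t a simple pole with residue
c. *)
Lemma local_residue (K : numFieldType) (c : nat) (t : K) (f g Q Q1 Phi : {poly K}) :
  let Z := 'X - t%:P in let h := g - 'X * f in
  (1 < c)%N -> Z ^+ c %| g - t *: f -> f.[t] != 0 -> Q = Z ^+ c * Q1 ->
  Q * (c%:R *: h^`() + c.-1%:R *: f) = h * Phi ->
  Z ^+ c %| c%:R *: Phi - Q^`().
Proof.
move=> Z h c_gt1 /dvdpP [w wE] ft QE.
set psi := _ + _ => QPhi.
case: c c_gt1 @psi wE QE QPhi => [//|[//|c]] _ psi wE QE QPhi.
pose h' := w * Z ^+ c.+1 - f.
have hE : h = Z * h'.
  have -> : h = (g - t *: f) - Z * f by rewrite /h /Z -mul_polyC; ring.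
  by rewrite wE /h' [Z ^+ c.+2]exprSr; ring.
have Zt : Z.[t] = 0 by rewrite hornerXsubC subrr.
have h't : h'.[t] = - f.[t].
  by rewrite hornerD hornerN hornerM horner_exp Zt expr0n mulr0 sub0r.
have nzZ : Z != 0 by rewrite polyXsubC_eq0.
have QPhi' : Z ^+ c.+1 * (Q1 * psi) = h' * Phi.
  by apply: (mulfI nzZ); rewrite [RHS]mulrA -hE -QPhi QE [Z ^+ c.+2]exprS !mulrA.
have cop : coprimep (Z ^+ c.+1) h'.
  by rewrite coprimep_expl // coprimep_sym coprimep_XsubC rootE h't oppr_eq0.
have /dvdpP [P1 PE] : Z ^+ c.+1 %| Phi.
  by rewrite -(Gauss_dvdpr _ cop) -QPhi' dvdp_mulr.
have eq1 : Q1 * psi = h' * P1.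
  by apply: (mulfI (expf_neq0 c.+1 nzZ)); rewrite QPhi' PE [P1 * _]mulrC mulrCA.
have psit : psi.[t] = - f.[t].
  rewrite /psi hE derivM derivXsubC mul1r hornerD !hornerZ hornerD hornerM.
  rewrite Zt mul0r addr0 h't.
  by rewrite -[in LHS]natr1 /=; ring.
have P1t : P1.[t] = Q1.[t].
  have := congr1 (horner^~ t) eq1; rewrite !hornerM psit h't mulrC !mulNr.
  by move/oppr_inj/(mulfI ft).
have -> : c.+2%:R *: Phi - Q^`() = Z ^+ c.+1 * (c.+2%:R *: (P1 - Q1) - Z * Q1^`()).
  rewrite QE derivM deriv_exp derivXsubC mul1r PE /=.
  rewrite -[Z ^+ _ *+ _]scaler_nat -!mul_polyC [Z ^+ c.+2]exprS.
  by ring.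
rewrite exprSr dvdp_mul2l ?expf_neq0 // dvdp_XsubCl rootE.
by rewrite hornerD hornerN hornerM Zt mul0r subr0 hornerZ hornerD hornerN P1t subrr mulr0.
Qed.

Section DoublePoint.
Variables (K : numFieldType) (n k c : nat) (t : 'I_n -> K).
Hypothesis c_gt1 : (1 < c)%N.
Hypothesis k_gt0 : (0 < k)%N.
Hypothesis le_ck : (c <= k)%N.
Hypothesis sum_c : (\sum_(i < n) c = k.*2)%N.
Hypothesis inj_t : injective t.
Let m := (fun=> c) : 'I_n -> nat.
Hypothesis rig : forall f g, solves k m (fun=> 1) t f g -> f = 0 /\ g = 0.
Implicit Types f g h p : {poly K}.
Let le_mk (i : 'I_n) : (m i <= k)%N := le_ck.

(** The condition wronskian0 says that at every point q some nonzero combination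
(f, g) of the frame has h(q) = psi(q) = 0, where h = g - X f and
psi = c h' + (c - 1) f.  These are the conditions that the limit of two colliding
points of multiplicity c satisfies at q. *)
Section Residues.
Variables f1 g1 f2 g2 : {poly K}.
Hypothesis fr : frame k m t f1 g1 f2 g2.

Let h1 := g1 - 'X * f1.
Let h2 := g2 - 'X * f2.
Let psi1 := c%:R *: h1^`() + c.-1%:R *: f1.
Let psi2 := c%:R *: h2^`() + c.-1%:R *: f2.
Let Q := arr_poly m t.
Let Phi := f1 * psi2 - f2 * psi1.
Hypothesis wronskian0 : h1 * psi2 = h2 * psi1.

Lemma Q_h : f1 * h2 - f2 * h1 = Q.
Proof. by rewrite /Q -(frame_det (m := m) sum_c inj_t fr) /h1 /h2; ring. Qed.

Lemma Q_psi1 : Q * psi1 = h1 * Phi.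
Proof.
rewrite -Q_h; transitivity (f1 * (h2 * psi1) - f2 * (h1 * psi1)); first by ring.
by rewrite -wronskian0 /Phi; ring.
Qed.

Lemma Q_psi2 : Q * psi2 = h2 * Phi.
Proof.
rewrite -Q_h; transitivity (f1 * (h2 * psi2) - f2 * (h1 * psi2)); first by ring.
by rewrite wronskian0 /Phi; ring.
Qed.

Lemma coef_h1 : h1`_k.+1 = -1.
Proof.
case: fr => [[sf1 sg1 _ _] _ [f1k g1k] _].
by rewrite coefB coefXM /= f1k nth_default // sub0r.
Qed.

Lemma size_h1 : size h1 = k.+2.
Proof.
case: fr => [[sf1 sg1 _ _] _ [f1k g1k] _].
apply/eqP; rewrite eqn_leq; apply/andP; split.
  apply: leq_trans (size_polyD _ _) _; rewrite geq_max size_polyN (leq_trans sg1) //=.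
  apply: leq_trans (size_polyMleq _ _) _; rewrite size_polyX.
  exact: sf1.
rewrite ltnNge; apply/negP => le; have /eqP := coef_h1.
by rewrite nth_default // eq_sym oppr_eq0 oner_eq0.
Qed.

Lemma size_psi1 : (size psi1 <= k.+1)%N.
Proof.
case: fr => [[sf1 sg1 _ _] _ _ _].
apply: leq_trans (size_polyD _ _) _; rewrite geq_max.
apply/andP; split; apply: leq_trans (size_scale_leq _ _) _ => //.
rewrite -ltnS -size_h1 lt_size_deriv //.
by rewrite -size_poly_eq0 size_h1.
Qed.

Lemma coef_psi1 : psi1`_k = - (c * k).+1%:R.
Proof.
case: fr => [_ _ [f1k g1k] _].
rewrite coefD !coefZ coef_deriv coef_h1 f1k mulNrn mulrN mulr1 -natrM.
have -> : (c * k.+1 = (c * k).+1 + c.-1)%N by rewrite mulnS; lia.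
by rewrite natrD opprD subrK.
Qed.

Lemma size_Phi : (size Phi <= k.*2)%N.
Proof.
case: (eqVneq Phi 0) => [->|nz]; first by rewrite size_poly0.
have nz_h1 : h1 != 0 by rewrite -size_poly_eq0 size_h1.
have := size_polyMleq Q psi1; rewrite Q_psi1 size_mul // size_h1.
have -> : size Q = k.*2.+1 := size_arr_poly t sum_c.
move: size_psi1; move: (size psi1) (size Phi) => x y; lia.
Qed.

(** Phi / Q is the common value of psi1 / h1 and psi2 / h2.  At each t_i one of
f1, f2 is nonzero, so [local_residue] controls the poles; both sides have
degree less than that of Q. *)
Lemma derivQ : Q^`() = c%:R *: Phi.
Proof.
case: fr => [[sf1 sg1 sf2 sg2] [tan1 tan2] [f1k g1k] [f2k g2k]].
have sQ : size Q = k.*2.+1 := size_arr_poly t sum_c.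
apply/esym/eqP; rewrite -subr_eq0; apply/eqP.
apply: (dvdp_small (d := Q)); last first.
  rewrite sQ ltnS; have sPhi := size_Phi.
  rewrite (leq_trans (size_polyD _ _)) // geq_max size_polyN.
  rewrite (leq_trans (size_scale_leq _ _)) //=.
  by rewrite -ltnS -sQ lt_size_deriv // monic_neq0 // monic_arr_poly.
apply: (arr_poly_dvdp inj_t) => i.
have QE : Q = ('X - (t i)%:P) ^+ c * arr_poly_off m t i by rewrite /Q (arr_poly_offE m t i).
case: (eqVneq f1.[t i] 0) => [f1t|nz]; last exact: local_residue c_gt1 (tan1 i) nz QE Q_psi1.
case: (eqVneq f2.[t i] 0) => [f2t|nz]; last exact: local_residue c_gt1 (tan2 i) nz QE Q_psi2.
have /dvdpP [w1] := tan1 i; rewrite mulrC => E1.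
have /dvdpP [w2] := tan2 i; rewrite mulrC => E2.
have := frame_local (m := m) sum_c inj_t fr E1 E2.
by rewrite hornerD hornerN !hornerM f1t f2t !mul0r subrr eqxx.
Qed.

(** The coefficients of X^(2k-1) in Q' = c Phi give 2k = c (ck + 1), which is
impossible for c > 1. *)
Lemma wronskian_absurd : False.
Proof.
have sQ : size Q = k.*2.+1 := size_arr_poly t sum_c.
have k2E : k.*2 = k.*2.-1.+1 by lia.
have PhiE : Phi`_k.*2.-1 = (c * k).+1%:R.
  apply: oppr_inj; rewrite -coef_psi1 -[RHS]mul1r.
  have := congr1 (fun p : {poly K} => p`_(k.*2 + k)) Q_psi1.
  rewrite (@coefM_top _ _ _ Q) ?sQ ?size_psi1 //.
  have -> : Q`_k.*2 = 1.
    by have := monicP (monic_arr_poly m t); rewrite lead_coefE -/Q sQ.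
  (* The degrees of both sides of Q psi1 = h1 Phi are at most 3k. *)
  have -> : (k.*2 + k = k.+1 + k.*2.-1)%N by lia.
  by rewrite coefM_top ?size_h1 -?k2E ?size_Phi // coef_h1 mulN1r mul1r => ->.
have := congr1 (fun p : {poly K} => p`_k.*2.-1) derivQ.
rewrite coef_deriv -k2E coefZ PhiE.
have -> : Q`_k.*2 = 1.
  by have := monicP (monic_arr_poly m t); rewrite lead_coefE -/Q sQ.
rewrite -natrM => /eqP; rewrite eqr_nat => /eqP eqn.
have : (2 * (2 * k) <= c * (c * k))%N by rewrite !leq_mul.
by move: eqn; rewrite mulnS; move: (c * (c * k))%N => x; lia.
Qed.

End Residues.

(** Otherwise, for every q, the equations h(q) = 0 and psi(q) = 0 on the plane
spanned by a frame are dependent, so their determinant vanishes identically. *)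
Lemma exists_double_point : exists q, (forall i, t i != q) /\
  forall f g u v, (size f <= k.+1)%N -> (size g <= k.+1)%N -> tangents m t f g ->
    f = c%:R *: u - ('X - q%:P) * v -> g - q *: f = ('X - q%:P) * u ->
    f = 0 /\ g = 0.
Proof.
apply: contrapT => none.
have [f1 [g1 [[sf1 sg1] tan1 f1k g1k]]] := frame_exists le_mk sum_c rig 1 0.
have [f2 [g2 [[sf2 sg2] tan2 f2k g2k]]] := frame_exists le_mk sum_c rig 0 1.
have fr : frame k m t f1 g1 f2 g2 by [].
apply: (wronskian_absurd fr); apply/eqP; rewrite -subr_eq0; apply/eqP.
apply: (@poly_nonroots0 _ _ (\prod_i ('X - (t i)%:P))).
  by rewrite monic_neq0 // monic_prod_XsubC.
move=> q nroot; apply: contrapT => /eqP nz; apply: none; exists q; split.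
  move=> i; apply: contra nroot => /eqP <-.
  by rewrite (bigD1 i) //= rootM root_XsubC eqxx.
move=> f g u v sf sg tan fE gE.
have [fab gab] := frame_span rig fr sf sg tan.
pose h := g - 'X * f; pose psi := c%:R *: h^`() + c.-1%:R *: f.
(* The two conditions at q become the vanishing of h and psi. *)
have hE : h = ('X - q%:P) * (u - f) by rewrite mulrBr -gE /h -mul_polyC; ring.
have hq : h.[q] = 0 by rewrite hE hornerM hornerXsubC subrr mul0r.
have psiq : psi.[q] = 0.
  rewrite /psi hE derivM derivXsubC mul1r hornerD !hornerZ hornerD hornerM.
  rewrite hornerXsubC subrr mul0r addr0 hornerD hornerN.
  have -> : f.[q] = c%:R * u.[q].
    by rewrite fE hornerD hornerN hornerM hornerXsubC subrr mul0r subr0 hornerZ.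
  have -> : c%:R = c.-1%:R + 1 :> K by rewrite natr1 prednK // ltnW.
  by ring.
move: fab gab; set a := f`_k; set b := g`_k => fab gab.
have hab : h = a *: (g1 - 'X * f1) + b *: (g2 - 'X * f2).
  by rewrite /h {1}gab {1}fab -!mul_polyC; ring.
have psiab : psi = a *: (c%:R *: (g1 - 'X * f1)^`() + c.-1%:R *: f1) +
     b *: (c%:R *: (g2 - 'X * f2)^`() + c.-1%:R *: f2).
  rewrite /psi; have -> : h^`() = a *: (g1 - 'X * f1)^`() + b *: (g2 - 'X * f2)^`().
    by rewrite hab [LHS]derivD !linearZ.
  by rewrite {1}fab -!mul_polyC; ring.
have f_eq0 : a = 0 -> b = 0 -> f = 0 /\ g = 0.
  by move=> a0 b0; rewrite fab gab a0 b0 !scale0r addr0.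
move: hq psiq nz; rewrite hab psiab.
set h1 := g1 - _; set h2 := g2 - _.
set p1 := _ + _ *: f1; set p2 := _ + _ *: f2.
move: h1 h2 p1 p2 => h1 h2 p1 p2; rewrite !(hornerD, hornerN, hornerM, hornerZ).
move=> eh ep nz; apply: f_eq0; apply: (mulIf nz); rewrite mul0r.
  transitivity ((a * h1.[q] + b * h2.[q]) * p2.[q] - h2.[q] * (a * p1.[q] + b * p2.[q])).
    by ring.
  by rewrite eh ep mul0r mulr0 subrr.
transitivity (h1.[q] * (a * p1.[q] + b * p2.[q]) - (a * h1.[q] + b * h2.[q]) * p1.[q]).
  by ring.
by rewrite eh ep mul0r mulr0 subrr.
Qed.

End DoublePoint.

(** * Existence of rigid configurations *)

Section Existence.
Variable K : numFieldType.

Lemma tangent_tangents (s : seq (K * nat)) n c (f g : {poly K}) :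
  map snd s = nseq n c ->
  tangent s f g <-> tangents (fun=> c) (fun i : 'I_n => (nth (0, 0%N) s i).1) f g.
Proof.
move=> snd_s; have sz : size s = n by rewrite -(size_map snd) snd_s size_nseq.
have cE i : (i < n)%N -> (nth (0, 0%N) s i).2 = c.
  by move=> lt_i; rewrite -(nth_map (0, 0%N) 0%N) ?sz // snd_s nth_nseq lt_i.
split=> [/allP tan i|tan].
  by rewrite -{1}(cE i (ltn_ord i)); apply: tan; rewrite mem_nth // sz.
apply/allP => x xs; have lt_i : (index x s < n)%N by rewrite -sz index_mem.
have := tan (Ordinal lt_i); rewrite /= -[c in _ ^+ c](cE _ lt_i).
by rewrite nth_index.
Qed.

(** Two points of multiplicity c collide at q; after division by (X - q)^(c-1)
the limit is a solution of degree at most k for the other points, and satisfies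
at q the conditions of [exists_double_point]. *)
Lemma rigid_points_double c n k : (1 < c)%N -> (1 < n)%N -> (n * c = k.*2)%N ->
  has_rigid_points K (nseq n c) -> has_rigid_points K [:: c, c & nseq n c].
Proof.
move=> c_gt1 n_gt1 sum_c [s [snd_s uniq_s]].
rewrite sumn_nseq mulnC sum_c doubleK => rig.
have le_ck : (c <= k)%N by nia.
have sz : size s = n by rewrite -(size_map snd) snd_s size_nseq.
pose t (i : 'I_n) := (nth (0, 0%N) s i).1.
have inj_t : injective t.
  move=> i j; rewrite /t -!(nth_map (0, 0%N) 0) ?sz // => /eqP.
  by rewrite nth_uniq ?size_map ?sz // => /eqP /val_inj.
have sum_I : (\sum_(i < n) c = k.*2)%N by rewrite sum_nat_const card_ord.
have [||q [q_t none]] := @exists_double_point K n k c t c_gt1 _ le_ck sum_I inj_t.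
- by lia.
- move=> f g /solves_tangent [sf sg tan]; apply: rig => //.
  exact/(tangent_tangents _ _ snd_s).
have q_s : q \notin map fst s.
  apply/(nthP 0) => -[j]; rewrite size_map sz => lt_j.
  by rewrite (nth_map (0, 0%N)) ?sz //; apply/eqP; apply: (q_t (Ordinal lt_j)).
apply: contrapT => nbal.
have cE : (c.-1.+1 = c)%N by rewrite prednK // ltnW.
have [|||||f [g [u [v [[sf sg] tan gE fE]]]]] := @collision K s q 0 c.-1 (k + c) => //.
- by rewrite cE; lia.
- apply/allP => x xs; have : x.2 \in nseq n c by rewrite -snd_s map_f.
  by rewrite mem_nseq => /andP[_ /eqP->]; lia.
- by rewrite snd_s sumn_nseq cE; lia.
- move=> e nz_e e_s rig'; case: nbal.
  rewrite !cE add0n in rig'.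
  exists [:: (q, c), (q + e, c) & s]; split; first by rewrite /= snd_s.
    rewrite /= inE negb_or q_s uniq_s e_s !andbT eq_sym -subr_eq0 addrC addKr nz_e //.
  suff -> : ((sumn [:: c, c & nseq n c])./2 = k + c)%N by [].
  by rewrite [sumn _]/= sumn_nseq; lia.
rewrite !add0n cE in gE fE.
pose T := 'X - q%:P : {poly K}.
pose f' := c%:R *: u - T * v; pose g' := q *: f' + T * u.
have TE : T ^+ c = T ^+ c.-1 * T by rewrite -exprSr cE.
have fE' : f = T ^+ c.-1 * f'.
  by rewrite fE -/T TE /f' -mulrA -mulrBr.
have gE' : g = T ^+ c.-1 * g'.
  apply/eqP; rewrite -subr_eq0 mulrDr mulrA -TE -scalerAr -fE' opprD addrA gE.
  by rewrite subrr.
have kE : (k + c - c.-1 = k.+1)%N by lia.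
case: (none f' g' u v) => //.
- by rewrite -kE; apply: quotient_size fE' sf.
- by rewrite -kE; apply: quotient_size gE' sg.
- apply/(tangent_tangents _ _ snd_s); apply: (tangent_cancel (j := c.-1) q_s).
  by rewrite -fE' -gE'.
- by rewrite /g' [_ + T * u]addrC addrK.
by move=> f0 g0; rewrite fE' gE' f0 g0 !mulr0 eqxx.
Qed.

(** With more than three points, a largest multiplicity M and a smallest
multiplicity mu < M are replaced by M - mu, and k by k - mu.  The bounds survive:
any other multiplicity x is at most M, and there is yet another one, at least
mu, so x + mu <= k; and size m <= k + 1 is inherited, for mu > 1
because 2k >= mu * size m.
If all multiplicities are equal, two of them are removed; the common value is
then not 1, because 2k >= 2 * size m - 2. *)
Theorem rigid_points_exist m k : (1 < size m)%N -> all (fun x => 0 < x <= k)%N m ->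
  sumn m = k.*2 -> (size m <= k.+1)%N -> has_rigid_points K m.
Proof.
have [N] := ubnP (size m); elim: N m k => // N IHN m k lt_m gt1 /allP le_m sum_m le_sz.
case: (leqP (size m) 3) => [le3|gt3].
  case: m gt1 le3 le_m sum_m {lt_m le_sz} => [|a [|b [|c [|]]]] //= _ _ le_m sum_m.
    have /andP[a0 ak] := le_m a (mem_head _ _).
    have /andP[b0 bk] : (0 < b <= k)%N by apply: le_m; rewrite !inE eqxx orbT.
    have -> : a = k by lia.
    have -> : b = k by lia.
    by apply: rigid_points2; lia.
  have /andP[a0 ak] := le_m a (mem_head _ _).
  have /andP[b0 bk] : (0 < b <= k)%N by apply: le_m; rewrite !inE eqxx orbT.
  have /andP[c0 ck] : (0 < c <= k)%N by apply: le_m; rewrite !inE eqxx !orbT.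
  by apply: (@rigid_points3 _ k); lia.
have [s ps sorted_s] : exists2 s, perm_eq s m & sorted leq s.
  by exists (sort leq m); [rewrite perm_sort | apply: sort_sorted; exact: leq_total].
apply: (rigid_points_perm ps).
have {le_m} le_s x : x \in s -> (0 < x <= k)%N by rewrite (perm_mem ps); apply: le_m.
rewrite -(perm_sumn ps) in sum_m.
move: lt_m gt1 le_sz gt3; rewrite -(perm_size ps) => lt_s gt1 le_sz gt3.
case: s {ps} => [//|mu s] in sorted_s le_s sum_m lt_s gt1 le_sz gt3 *.
case/lastP: s => [//|s M] in sorted_s le_s sum_m lt_s gt1 le_sz gt3 *.
have mu_le x : x \in rcons s M -> (mu <= x)%N.
  by move=> xs; have /allP := order_path_min leq_trans sorted_s; apply.
have M_ge x : x \in mu :: s -> (x <= M)%N.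
  move: sorted_s; rewrite (sorted_pairwise leq_trans) -rcons_cons pairwise_rcons.
  by case/andP => /allP le_M _ /le_M.
have mu0 : (0 < mu)%N by have /andP[] := le_s mu (mem_head _ _).
have Mk : (M <= k)%N.
  suff /andP[] : (0 < M <= k)%N by [].
  by apply: le_s; rewrite inE mem_rcons mem_head orbT.
have le_xs x : x \in s -> (0 < x <= k)%N.
  by move=> xs; apply: le_s; rewrite inE mem_rcons inE xs !orbT.
rewrite /= sumn_rcons in sum_m.
rewrite /= size_rcons in lt_s le_sz gt3.
have sum_lb r : {subset r <= s} -> (size r * mu <= sumn r)%N.
  elim: r => //= y r IHr sub; rewrite mulSn leq_add //.
    by apply: mu_le; rewrite mem_rcons inE sub ?mem_head ?orbT.
  by apply: IHr => x xr; rewrite sub // inE xr orbT.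
have sum_ge : (size s * mu <= sumn s)%N by apply: sum_lb.
(* All multiplicities are equal in the first case. *)
have [eqM|neM] := eqVneq mu M.
  rewrite -eqM; have sE : s = nseq (size s) mu.
    apply/all_pred1P/allP => x xs /=; rewrite eqn_leq mu_le ?mem_rcons ?inE ?xs ?orbT // andbT.
    by rewrite eqM M_ge // inE xs orbT.
  have pm : perm_eq [:: mu, mu & s] (mu :: rcons s mu) by rewrite perm_cons perm_sym perm_rcons.
  apply: (rigid_points_perm pm); rewrite sE.
  have sum_s : sumn s = (size s * mu)%N by rewrite {1}sE sumn_nseq mulnC.
  move: (size s) sum_s lt_s le_sz gt3 {sE pm sum_ge} => n sum_s lt_s le_sz gt3.
  have mu2 : (1 < mu)%N by case: (mu) mu0 sum_s sum_m eqM => [|[|]] //; lia.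
  apply: (@rigid_points_double mu n (k - mu)) => //; first by lia.
  apply: (IHN _ (k - mu)%N); rewrite ?size_nseq ?sumn_nseq; try lia.
  by apply/allP => x; rewrite mem_nseq => /andP[_ /eqP ->]; nia.
  by nia.
have lt_mu : (mu < M)%N by rewrite ltn_neqAle neM mu_le // mem_rcons mem_head.
have pm : perm_eq [:: M, mu & s] (mu :: rcons s M).
  by rewrite -(cat1s M) -(cat1s mu (rcons _ _)) perm_sym -cats1 catA perm_catC.
apply: (rigid_points_perm pm).
have [l muE] : exists l, mu = l.+1 by exists mu.-1; rewrite prednK.
have [d ME] : exists d, M = (d.+1 + l.+1)%N by exists (M - mu).-1; lia.
have le_xmu x : x \in s -> (x + mu <= k)%N.
  move=> xs; have sumE : sumn s = (x + sumn (rem x s))%N.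
    by rewrite (perm_sumn (perm_to_rem xs)).
  have := sum_lb _ (@mem_rem _ x s); rewrite size_rem //.
  have : (x <= M)%N by apply: M_ge; rewrite inE xs orbT.
  have : (mu <= (size s).-1 * mu)%N by rewrite leq_pmull // -subn1 subn_gt0; exact: gt3.
  by move: sum_m; rewrite sumE; lia.
rewrite ME muE; apply: (@rigid_points_merge _ d l s k).
- by lia.
- by apply/allP => x /le_xs /andP[].
- by lia.
apply: (IHN _ (k - mu)%N); rewrite /=; try lia.
- apply/andP; split; first by lia.
  by apply/allP => x xs; have := le_xmu x xs; have := le_xs x xs; lia.
- have [mu1|mu1] : mu = 1%N \/ (1 < mu)%N by lia.
    by lia.
  have : (size s * 2 <= size s * mu)%N by rewrite leq_mul.
  by move: sum_m sum_ge; move: (size s) (sumn s) (size s * mu)%N => x y z; lia.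
Qed.

End Existence.

(** * Multihomogeneity of the determinant *)

Section Multihomogeneous.
Variables (K : fieldType) (n : nat).
Local Notation R := {mpoly K[n * 2]}.
Implicit Types (F G : R) (d e : 'I_n -> nat).

Lemma multihomog0 d : multihomog d (0 : R).
Proof. by move=> mon; rewrite msupp0. Qed.

Lemma multihomogD d F G : multihomog d F -> multihomog d G -> multihomog d (F + G).
Proof.
by move=> hF hG mon /msuppD_le; rewrite mem_cat => /orP[/hF|/hG].
Qed.

Lemma multihomogN d F : multihomog d F -> multihomog d (- F).
Proof. by move=> hF mon; rewrite (perm_mem (msuppN _)); apply: hF. Qed.

Lemma multihomogM d e F G :
  multihomog d F -> multihomog e G -> multihomog (fun i => d i + e i)%N (F * G).
Proof.
move=> hF hG mon /msuppM_le /allpairsP[[m1 m2] /= [m1F m2G ->]] i.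
rewrite -(hF _ m1F i) -(hG _ m2G i) -big_split.
by apply: eq_bigr => j _; rewrite mnmDE.
Qed.

Lemma multihomog1 : multihomog (fun=> 0%N) (1 : R).
Proof.
move=> mon; rewrite msupp1 inE => /eqP -> i.
by rewrite big1 // => j _; rewrite mnm0E.
Qed.

Lemma multihomog_eq d e F : multihomog d F -> d =1 e -> multihomog e F.
Proof. by move=> hF de mon /hF h i; rewrite h de. Qed.

Lemma multihomog_sum (I : Type) (r : seq I) (P : pred I) (F : I -> R) d :
  (forall i, P i -> multihomog d (F i)) -> multihomog d (\sum_(i <- r | P i) F i).
Proof.
move=> hF; elim/big_rec: _ => [|i G Pi hG]; first exact: multihomog0.
by apply: multihomogD => //; apply: hF.
Qed.

Lemma multihomog_prod (I : Type) (r : seq I) (F : I -> R) (d : I -> 'I_n -> nat) :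
  (forall i, multihomog (d i) (F i)) ->
  multihomog (fun x => \sum_(i <- r) d i x)%N (\prod_(i <- r) F i).
Proof.
move=> hF; elim: r => [|i r IHr].
  rewrite big_nil; apply: (multihomog_eq multihomog1) => x; by rewrite big_nil.
rewrite big_cons; apply: (multihomog_eq (multihomogM (hF i) IHr)) => x.
by rewrite big_cons.
Qed.

Lemma multihomog_X (i : 'I_n) (j : 'I_2) :
  multihomog (fun i' => (i' == i)%N) ('X_(mxvec_index i j) : R).
Proof.
move=> mon; rewrite msuppX inE => /eqP -> i'.
under eq_bigr do rewrite mnm1E.
rewrite (eq_bigr (fun j' => ((i' == i) && (j' == j)) : nat)); last first.
  move=> j' _; congr (nat_of_bool _).
  have inj : injective (uncurry (@mxvec_index n 2)).
    have [g gK _] := curry_mxvec_bij n 2.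
    by move=> x y eq_xy; rewrite -(gK x) ?inE // eq_xy gK ?inE.
  transitivity ((i, j) == (i', j')); first exact: (inj_eq inj (i, j) (i', j')).
  by rewrite xpair_eqE [i == _]eq_sym [j == _]eq_sym.
case: (i' == i) => /=; last by rewrite big1.
by rewrite (bigD1 j) //= eqxx big1 ?addn0 // => j' /negbTE ->.
Qed.

(** A determinant is multihomogeneous as soon as the degree of each entry is the
sum of a degree attached to its row and one attached to its column. *)
Lemma multihomog_det N (A : 'M[R]_N) (rho gam : 'I_N -> 'I_n -> nat) :
  (forall r c, multihomog (fun i => rho r i + gam c i)%N (A r c)) ->
  multihomog (fun i => \sum_r (rho r i + gam r i))%N (\det A).
Proof.
move=> hA; apply: multihomog_sum => s _.
have hs : multihomog (fun=> 0%N) ((-1) ^+ odd_perm s : R).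
  by case: (odd_perm s); [apply/multihomogN|]; apply: multihomog1.
apply: (multihomog_eq (multihomogM hs (multihomog_prod (fun r => hA r (s r))))) => i.
rewrite add0n !big_split /=; congr (_ + _)%N.
by rewrite [RHS](reindex_inj (@perm_inj _ s)).
Qed.

Definition coefs_multihomog d (p : {poly R}) := forall j, multihomog d p`_j.

Lemma coefs_multihomogM d e p q : coefs_multihomog d p -> coefs_multihomog e q ->
  coefs_multihomog (fun i => d i + e i)%N (p * q).
Proof.
move=> hp hq j; rewrite coefM; apply: multihomog_sum => l _.
exact: multihomogM.
Qed.

Lemma coefs_multihomog1 : coefs_multihomog (fun=> 0%N) 1.
Proof.
by move=> j; rewrite coef1; case: eqP => _; [apply: multihomog1 | apply: multihomog0].
Qed.

Lemma coefs_multihomog_exp d p l : coefs_multihomog d p ->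
  coefs_multihomog (fun i => l * d i)%N (p ^+ l).
Proof.
move=> hp; elim: l => [|l IHl]; first exact: coefs_multihomog1.
by rewrite exprS; apply: coefs_multihomogM.
Qed.

Definition acoord (i : 'I_n) : R := 'X_(mxvec_index i 0).
Definition bcoord (i : 'I_n) : R := 'X_(mxvec_index i 1).
Let single (i i' : 'I_n) : nat := (i' == i).

Lemma coefs_multihomogC d c l : multihomog d c -> coefs_multihomog d (c *: 'X^l : {poly R}).
Proof.
move=> hc j; rewrite coefZ coefXn; case: eqP => _; first by rewrite mulr1.
by rewrite mulr0; apply: multihomog0.
Qed.

Lemma coefs_multihomog_lform i : coefs_multihomog (single i) (lform acoord bcoord i).
Proof.
move=> j; rewrite coefB coefC; apply: multihomogD.
  by rewrite -['X]expr1; apply: coefs_multihomogC; apply: multihomog_X.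
apply: multihomogN; case: ifP => _; last exact: multihomog0.
exact: multihomog_X.
Qed.

Variables (k : nat) (m : 'I_n -> nat).
Hypothesis le_mk : forall i, (m i <= k)%N.
Hypothesis sum_m : (\sum_i m i = k.*2)%N.
Hypothesis m_gt0 : forall i, (0 < m i)%N.

(** In equation i the coordinates of point i enter with degree 1 in the columns of
f and g, and with degree m_i in those of w_i.  The equation carries the degree
1, so the unknown carries the difference, which is 0 or m_i - 1. *)
Definition unknown_degree (u : unknown k m) (i : 'I_n) : nat :=
  match u with inl _ => 0%N | inr (existT i' _) => ((m i').-1 * single i' i)%N end.

Lemma multihomog_column u i j :
  multihomog (fun i' => unknown_degree u i' + single i i')%N (column acoord bcoord u i)`_j.
Proof.
case: u => [[l|l]|[i' l]] /=.
- by apply: coefs_multihomogC; apply/multihomogN/multihomog_X.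
- by apply: coefs_multihomogC; apply/multihomog_X.
case: eqP => [<-|_]; last by rewrite coef0; apply: multihomog0.
have hX : coefs_multihomog (fun=> 0%N) ('X^l : {poly R}).
  by rewrite -[_ ^+ _]scale1r; apply: coefs_multihomogC; apply: multihomog1.
rewrite mulNr coefN; apply: multihomogN.
have := coefs_multihomogM (coefs_multihomog_exp (l := m i') (@coefs_multihomog_lform i')) hX.
move=> /(_ j) /multihomog_eq; apply=> x.
by rewrite addn0 -mulSnr prednK.
Qed.

Lemma multihomog_det_sysmx : exists d, multihomog d (\det (sysmx le_mk sum_m acoord bcoord)).
Proof.
eexists; apply: (multihomog_det
  (rho := fun r i =>
     unknown_degree (enum_val (cast_ord (card_unknown le_mk sum_m) r)) i)
  (gam := fun c i => single (enum_val c : equation n k).1 i)) => r c.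
rewrite mxE; exact: multihomog_column.
Qed.

Lemma multihomog_prod_acoord : multihomog (fun=> 1%N) (\prod_i acoord i).
Proof.
apply: (multihomog_eq (multihomog_prod (fun i => @multihomog_X i 0))) => i.
by rewrite (bigD1 i) //= eqxx big1 // => j /negbTE; rewrite eq_sym => ->.
Qed.

End Multihomogeneous.

(** * Derivations and divisibility by linear forms *)

Section Bivariate.
Variable K : numFieldType.
Local Notation S := {mpoly K[2]}.
Implicit Types (P F G A B : S) (t : K) (theta : S -> S).

Lemma ord2P (i : 'I_2) : i = 0 \/ i = 1.
Proof. by case: i => [[|[|//]] lt_i]; [left | right]; apply: val_inj. Qed.

Lemma mderivXU (i j : 'I_2) : ('X_i : S)^`M(j) = (i == j)%:R.
Proof.
rewrite mderivX mnm1E; case: eqVneq => [->|_]; last by rewrite scale0r.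
have -> : (U_(j) - U_(j))%MM = 0%MM :> 'X_{1..2}.
  by apply/mnmP => l; rewrite mnmBE subnn mnm0E.
by rewrite scale1r mpolyX0.
Qed.

Lemma derivationE theta : derivation theta -> forall P,
  theta P = theta 'X_0 * P^`M(0) + theta 'X_1 * P^`M(1).
Proof.
case=> lin_th leib P.
have th0 : theta 0 = 0.
  by have := lin_th (- 1) 0 0; rewrite scaler0 addr0 scaleN1r addrC subrr.
have thD A B : theta (A + B) = theta A + theta B.
  by have := lin_th 1 A B; rewrite !scale1r.
have thZ c A : theta (c *: A) = c *: theta A.
  by have := lin_th c A 0; rewrite !addr0 th0 addr0.
have th1 : theta 1 = 0.
  have := leib 1 1; rewrite !mulr1 mul1r => /eqP.
  by rewrite -subr_eq0 opprD addrA subrr sub0r oppr_eq0 => /eqP.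
pose good A := theta A = theta 'X_0 * A^`M(0) + theta 'X_1 * A^`M(1).
have good1 : good 1 by rewrite /good -mpolyC1 !mderivC !mulr0 addr0 mpolyC1.
have goodM A B : good A -> good B -> good (A * B).
  by rewrite /good leib => -> ->; rewrite !mderivM; ring.
have goodX i : good 'X_i.
  by rewrite /good !mderivXU; have [->|->] := ord2P i; rewrite /= mulr1 mulr0 ?addr0 ?add0r.
have goodXn i l : good ('X_i ^+ l).
  by elim: l => [|l IHl]; [rewrite expr0 | rewrite exprS; apply: goodM].
elim/mpolyind: P => [|c mon P _ _ IHP].
  by rewrite th0 !mderiv0 !mulr0 addr0.
have goodm : good 'X_[mon].
  by rewrite mpolyXE_id; elim/big_ind: _ => // i _; apply: goodXn.
by rewrite thD thZ goodm IHP !mderivD !mderivZ -!mul_mpolyC; ring.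
Qed.

Definition derivation_of F G P := F * P^`M(0) + G * P^`M(1).

Lemma derivation_ofP F G : derivation (derivation_of F G).
Proof.
split=> [c A B|A B]; rewrite /derivation_of.
  by rewrite !mderivD !mderivZ -!mul_mpolyC; ring.
by rewrite !mderivM; ring.
Qed.

Definition affine_form t : S := 'X_1 - t *: 'X_0.

(** Restriction to the line y = t x, as a polynomial in x. *)
Definition on_line t P : S := P \mPo [tuple 'X_0; t *: 'X_0].

HB.instance Definition _ t :=
  GRing.RMorphism.copy (on_line t) (comp_mpoly [tuple 'X_0; t *: 'X_0]).

Definition divides A B := exists C, B = A * C.

Lemma on_lineX0 t : on_line t 'X_0 = 'X_0.
Proof. by rewrite /on_line comp_mpolyXU. Qed.

Lemma on_lineX1 t : on_line t 'X_1 = t *: 'X_0.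
Proof. by rewrite /on_line comp_mpolyXU. Qed.

Lemma on_lineZ t c P : on_line t (c *: P) = c *: on_line t P.
Proof. exact: comp_mpolyZ. Qed.

Lemma on_line_affine_form t s : on_line t (affine_form s) = (t - s) *: 'X_0.
Proof. by rewrite /affine_form rmorphB /= on_lineZ on_lineX0 on_lineX1 scalerBl. Qed.

(** The polynomials congruent to their restriction modulo y - t x form a
subalgebra that contains x and y. *)
Lemma affine_form_divides t P : divides (affine_form t) P <-> on_line t P = 0.
Proof.
split=> [[C ->]|P0]; first by rewrite rmorphM /= on_line_affine_form subrr scale0r mul0r.
suff : divides (affine_form t) (P - on_line t P) by rewrite P0 subr0.
pose good A := divides (affine_form t) (A - on_line t A).
have goodM A B : good A -> good B -> good (A * B).
  move=> [C EA] [D EB]; exists (C * B + on_line t A * D).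
  rewrite rmorphM mulrDr mulrA -EA [affine_form t * _]mulrCA -EB; ring.
have good1 : good 1 by exists 0; rewrite rmorph1 subrr mulr0.
have goodX i : good 'X_i.
  have [->|->] := ord2P i; first by exists 0; rewrite on_lineX0 subrr mulr0.
  by exists 1; rewrite on_lineX1 mulr1.
have goodXn i l : good ('X_i ^+ l).
  by elim: l => [|l IHl]; [rewrite expr0 | rewrite exprS; apply: goodM].
elim/mpolyind: (P) => [|c mon A _ _ [C EA]].
  by exists 0; rewrite rmorph0 subrr mulr0.
have [D ED] : good 'X_[mon].
  by rewrite mpolyXE_id; elim/big_ind: _ => // i _; apply: goodXn.
exists (c *: D + C); rewrite mulrDr -scalerAr -ED -EA scalerBr.
have -> : on_line t (c *: 'X_[mon] + A) = c *: on_line t 'X_[mon] + on_line t A.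
  by rewrite rmorphD /= on_lineZ.
by ring.
Qed.

End Bivariate.

(** * The criterion of Saito for two generators *)

Section Saito.
Variable K : numFieldType.
Local Notation S := {mpoly K[2]}.
Implicit Types (P F G A B C : S) (t : K).

Lemma mpolyX_neq0 (i : 'I_2) : 'X_i != 0 :> S.
Proof.
apply/eqP => /(congr1 (@mderiv _ _ i)) /eqP.
by rewrite mderiv0 mderivXU eqxx oner_eq0.
Qed.

Lemma affine_form_neq0 t : affine_form t != 0.
Proof.
apply/eqP => /(congr1 (@mderiv _ _ 1)) /eqP.
by rewrite mderiv0 mderivB mderivZ !mderivXU /= scaler0 subr0 oner_eq0.
Qed.

(** Restriction to a line is a ring morphism to a domain, so its kernel is
prime. *)
Lemma affine_form_prime t d B C : on_line t B != 0 ->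
  divides (affine_form t ^+ d) (B * C) -> divides (affine_form t ^+ d) C.
Proof.
move=> nzB; elim: d C => [|d IHd] C [D ED]; first by exists C; rewrite expr0 mul1r.
have /affine_form_divides /eqP : divides (affine_form t) (B * C).
  by exists (affine_form t ^+ d * D); rewrite mulrA -exprS.
rewrite rmorphM mulf_eq0 (negbTE nzB) /= => /eqP /affine_form_divides [C' EC].
have [|D' ED'] := IHd C'; last by exists D'; rewrite EC ED' mulrA -exprS.
exists D; apply: (mulfI (affine_form_neq0 t)).
by rewrite mulrCA -EC ED exprS mulrA.
Qed.

Variables (n : nat) (t : 'I_n -> K) (m : 'I_n -> nat).
Hypothesis inj_t : injective t.

Definition arr_form : S := \prod_i affine_form (t i) ^+ m i.

Lemma arr_form_neq0 : arr_form != 0.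
Proof. by apply/prodf_neq0 => i _; rewrite expf_neq0 ?affine_form_neq0. Qed.

Lemma arr_form_divides P : (forall i, divides (affine_form (t i) ^+ m i) P) -> divides arr_form P.
Proof.
move=> dv; rewrite /arr_form.
have : uniq (index_enum 'I_n) by exact: index_enum_uniq.
elim: (index_enum _) => [|i r IHr] /=; first by exists P; rewrite big_nil mul1r.
move=> /andP[ni /IHr [C EC]].
have [||D ED] := @affine_form_prime (t i) (m i) (\prod_(j <- r) affine_form (t j) ^+ m j) C.
- rewrite rmorph_prod /= prodf_seq_neq0; apply/allP => j jr /=.
  rewrite rmorphXn /= on_line_affine_form expf_neq0 // scaler_eq0 negb_or mpolyX_neq0 andbT.
  by rewrite subr_eq0 (inj_eq inj_t); apply: contraNneq ni => ->.
- by rewrite -EC; apply: dv.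
by exists D; rewrite big_cons EC ED mulrA [X in _ = X * _]mulrC.
Qed.

Definition tangent_form F G := forall i, divides (affine_form (t i) ^+ m i) (G - t i *: F).

Lemma det_divides F1 G1 F2 G2 : tangent_form F1 G1 -> tangent_form F2 G2 ->
  divides arr_form (F1 * G2 - F2 * G1).
Proof.
move=> tan1 tan2; apply: arr_form_divides => i.
have [C1 E1] := tan1 i; have [C2 E2] := tan2 i.
exists (F1 * C2 - F2 * C1).
have -> : F1 * G2 - F2 * G1 = F1 * (G2 - t i *: F2) - F2 * (G1 - t i *: F1).
  by rewrite -!mul_mpolyC; ring.
by rewrite E1 E2; ring.
Qed.

(** Cramer's rule: the determinants of (F, G) with the two generators are multiples
of the product of the forms, and that product is the determinant of the
generators up to a nonzero constant. *)
Lemma saito F1 G1 F2 G2 (c : K) : c != 0 -> F1 * G2 - F2 * G1 = c *: arr_form ->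
  tangent_form F1 G1 -> tangent_form F2 G2 ->
  forall F G, tangent_form F G ->
  exists A B, F = A * F1 + B * F2 /\ G = A * G1 + B * G2.
Proof.
move=> nz_c det tan1 tan2 F G tan.
have [A EA] := det_divides tan tan2; have [B EB] := det_divides tan1 tan.
exists (c^-1 *: A), (c^-1 *: B).
have QF P Q : c *: arr_form * P = arr_form * Q -> P = c^-1 *: Q.
  rewrite -scalerAl scalerAr => /(mulfI arr_form_neq0) <-.
  by rewrite scalerA mulVf ?scale1r.
split; rewrite -!scalerAl -scalerDr; apply: QF; rewrite -det mulrDr !mulrA -EA -EB; ring.
Qed.

End Saito.

(** * From univariate solutions to exponents *)

Section Homogenize.
Variable K : numFieldType.
Local Notation S := {mpoly K[2]}.
Implicit Types (p q : {poly K}) (t : K).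

Definition homogenize d p : S := \sum_(i < d.+1) p`_i *: ('X_0 ^+ (d - i) * 'X_1 ^+ i).

Lemma dhomogXU (i : 'I_2) : ('X_i : S) \is 1.-homog.
Proof. by rewrite dhomogX /= mdeg1. Qed.

Lemma homogenize_dhomog d p : homogenize d p \is d.-homog.
Proof.
apply: rpred_sum => i _; apply: dhomogZ.
have hom (a b : nat) : ('X_0 ^+ a * 'X_1 ^+ b : S) \is (a + b).-homog.
  apply: dhomogM.
    by rewrite -{2}[a]mul1n; apply: dhomogMn; exact: dhomogXU.
  by rewrite -{2}[b]mul1n; apply: dhomogMn; exact: dhomogXU.
by have := hom (d - i)%N i; rewrite subnK // -ltnS.
Qed.

Lemma homogenizeB d p q : homogenize d (p - q) = homogenize d p - homogenize d q.
Proof. by rewrite /homogenize -sumrB; apply: eq_bigr => i _; rewrite coefB scalerBl. Qed.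

Lemma homogenizeZ d c p : homogenize d (c *: p) = c *: homogenize d p.
Proof. by rewrite /homogenize scaler_sumr; apply: eq_bigr => i _; rewrite coefZ scalerA. Qed.

Lemma homogenizeM d e p q : (size p <= d.+1)%N -> (size q <= e.+1)%N ->
  homogenize (d + e) (p * q) = homogenize d p * homogenize e q.
Proof.
move=> sp sq.
have hsum (I : finType) (G : I -> {poly K}) c :
    homogenize c (\sum_i G i) = \sum_i homogenize c (G i).
  rewrite /homogenize exchange_big; apply: eq_bigr => i _ /=.
  by rewrite coef_sum scaler_suml.
rewrite -{1}(spread_coef sp) -{1}(spread_coef sq) big_distrlr /= hsum.
rewrite /homogenize big_distrlr /=; apply: eq_bigr => i _; rewrite -/(homogenize _ _) hsum.
apply: eq_bigr => j _.
have lt_ij : (i + j < (d + e).+1)%N by rewrite ltnS leq_add // -ltnS.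
rewrite -scalerAl -scalerAr -exprD !homogenizeZ /homogenize.
rewrite (bigD1 (Ordinal lt_ij)) //= big1 => [|l]; last first.
  by rewrite coefXn -val_eqE /= => /negbTE ->; rewrite scale0r.
rewrite coefXn eqxx scale1r addr0 -scalerAl -scalerAr; congr (_ *: (_ *: _)).
have [lei lej] : (i <= d)%N /\ (j <= e)%N by split; rewrite -ltnS.
have -> : (d + e - (i + j) = (d - i) + (e - j))%N by lia.
by rewrite !exprD; ring.
Qed.

Lemma homogenize_XsubC t : homogenize 1 ('X - t%:P) = affine_form t.
Proof.
rewrite /homogenize !big_ord_recr big_ord0 /= !coefB !coefX !coefC /=.
by rewrite add0r sub0r subr0 !expr0 !expr1 mulr1 mul1r scale1r scaleNr addrC.
Qed.

Lemma homogenize1 : homogenize 0 1 = 1.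
Proof. by rewrite /homogenize big_ord_recr big_ord0 /= coef1 add0r scale1r mulr1. Qed.

Lemma homogenize_XsubC_exp t d : homogenize d (('X - t%:P) ^+ d) = affine_form t ^+ d.
Proof.
elim: d => [|d IHd]; first exact: homogenize1.
by rewrite !exprS -IHd -[d.+1]add1n homogenizeM ?homogenize_XsubC // ?size_XsubC ?size_exp_XsubC.
Qed.

End Homogenize.

Section Exponents.
Variable K : numFieldType.
Local Notation S := {mpoly K[2]}.

Lemma linear_formE (P : S) : P \is 1.-homog ->
  P = P@_U_(0) *: 'X_0 + P@_U_(1) *: 'X_1.
Proof.
move=> homP; apply/mpolyP => mon; rewrite mcoeffD !mcoeffZ !mcoeffX.
case: (eqVneq (mdeg mon) 1%N) => [deg1|deg1]; last first.
  rewrite (dhomog_nemf_coeff homP) //.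
  have ne i : (U_(i)%MM == mon :> 'X_{1..2}) = false.
    by apply: contra_neqF deg1 => /eqP <-; rewrite mdeg1.
  by rewrite !ne !mulr0 addr0.
have /existsP [i /eqP ->] : [exists i, mon == U_(i)%MM] by rewrite -mdeg_eq1 deg1.
rewrite !eq_mnm1; have [->|->] := ord2P i; by rewrite /= mulr1 mulr0 ?addr0 ?add0r.
Qed.

Variables (n : nat) (p : 'I_n -> proj_line K) (t : 'I_n -> K) (m : 'I_n -> nat).
Hypothesis inj_t : injective t.
Hypothesis p_line : forall i (v : 'rV[K]_2), (v \in val (p i)) = (v 0 1 == t i * v 0 0).

Lemma meval_affine_form (s : K) (v : 'I_2 -> K) : (affine_form s).@[v] = v 1 - s * v 0.
Proof. by rewrite mevalB mevalZ !mevalXU. Qed.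

Lemma defining_affine_form i : defining_form (p i) (affine_form (t i)).
Proof.
split; first exact: affine_form_neq0.
  by rewrite rpredB ?dhomogZ ?dhomogXU.
move=> v; rewrite p_line meval_affine_form.
by split=> [/eqP ->|/eqP]; rewrite ?subrr // subr_eq0.
Qed.

Lemma defining_formE i alpha : defining_form (p i) alpha ->
  exists2 c : K, c != 0 & alpha = c *: affine_form (t i).
Proof.
move=> [nz hom ker]; move: nz; rewrite (linear_formE hom).
set a := alpha@_U_(0); set b := alpha@_U_(1) => nz.
have ab : a = - (b * t i).
  pose v : 'rV[K]_2 := \row_j (if j == 0 then 1 else t i).
  have : alpha.@[v 0] = 0 by apply/ker; rewrite p_line !mxE /= mulr1.
  rewrite (linear_formE hom) -/a -/b mevalD !mevalZ !mevalXU !mxE /= mulr1.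
  by move/eqP; rewrite addr_eq0 => /eqP.
have E : a *: 'X_0 + b *: 'X_1 = b *: affine_form (t i).
  by rewrite ab /affine_form scalerBr scalerA scaleNr addrC.
exists b => //; apply: contraNneq nz => b0.
by rewrite E b0 scale0r.
Qed.

(** A form defining p_i is a nonzero multiple of y - t_i x, on which a derivation
with components F and G takes the value G - t_i F. *)
Lemma der_moduleP (theta : S -> S) : der_module p m theta <->
  derivation theta /\ tangent_form t m (theta 'X_0) (theta 'X_1).
Proof.
split=> -[der tan]; split=> // i.
  have [C EC] := tan i _ (defining_affine_form i); exists C; rewrite -EC.
  rewrite [RHS](derivationE der) !mderivB !mderivZ !mderivXU /= scaler0 subr0 mulr1.
  by rewrite sub0r mulrN -scalerAr mulr1 addrC.
move=> alpha /defining_formE [c nz_c ->].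
have [C EC] := tan i; exists ((c / c ^+ m i) *: C).
rewrite exprZn -scalerAl -scalerAr scalerA mulrCA mulfV ?expf_neq0 // mulr1 -EC.
rewrite [LHS](derivationE der) !mderivZ !mderivB !mderivZ !mderivXU /= scaler0 subr0.
by rewrite sub0r -!mul_mpolyC; ring.
Qed.

Lemma derivation_ofX (F G : S) : derivation_of F G 'X_0 = F /\ derivation_of F G 'X_1 = G.
Proof.
by rewrite /derivation_of !mderivXU /= !mulr1 !mulr0 addr0 add0r.
Qed.

Lemma tangent_form_homogenize d (f g : {poly K}) : (size f <= d.+1)%N ->
  (size g <= d.+1)%N -> tangents m t f g ->
  tangent_form t m (homogenize d f) (homogenize d g).
Proof.
move=> sf sg tan i; have /dvdpP [w] := tan i; rewrite mulrC => wE.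
rewrite -homogenizeZ -homogenizeB.
have sz : (size (g - t i *: f)%R <= d.+1)%N.
  rewrite (leq_trans (size_polyD _ _)) // geq_max sg size_polyN.
  exact: leq_trans (size_scale_leq _ _) sf.
have [w0|nz_w] := eqVneq w 0.
  by exists 0; rewrite wE w0 !mulr0 -[X in homogenize d X](scale0r 0) homogenizeZ scale0r.
have sw := quotient_size wE sz.
have w_gt0 : (0 < size w)%N by rewrite lt0n size_poly_eq0.
have le_md : (m i <= d)%N by rewrite -ltnS -subn_gt0 (leq_trans w_gt0).
exists (homogenize (d - m i) w).
rewrite wE -homogenize_XsubC_exp -homogenizeM ?size_exp_XsubC //.
  by rewrite subnKC.
by rewrite -subSn.
Qed.

Lemma homogenize_arr_poly : homogenize (\sum_i m i)%N (arr_poly m t) = arr_form t m.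
Proof.
rewrite /arr_poly /arr_form.
elim: (index_enum _) => [|i r IHr]; first by rewrite !big_nil homogenize1.
rewrite !big_cons homogenizeM ?homogenize_XsubC_exp ?IHr ?size_exp_XsubC //.
elim: {i IHr} r => [|i r IHr]; first by rewrite !big_nil size_poly1.
rewrite !big_cons size_monicM ?monic_exp ?monicXsubC //.
  by rewrite size_exp_XsubC /= -addnS leq_add2l.
by rewrite monic_neq0 // monic_prod // => j _; rewrite monic_exp ?monicXsubC.
Qed.

(** The dehomogenized criterion: two solutions whose degrees add up to the total
multiplicity, with determinant a nonzero multiple of the product of the
(X - t_i)^{m_i}. *)
Lemma exponents_of_pair (c : K) (d1 d2 : nat) (f1 g1 f2 g2 : {poly K}) :
  (d1 <= d2)%N -> (d1 + d2 = \sum_i m i)%N -> c != 0 ->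
  (size f1 <= d1.+1)%N -> (size g1 <= d1.+1)%N ->
  (size f2 <= d2.+1)%N -> (size g2 <= d2.+1)%N ->
  tangents m t f1 g1 -> tangents m t f2 g2 ->
  f1 * g2 - f2 * g1 = c *: arr_poly m t ->
  exponents p m (d1, d2).
Proof.
move=> le_d sum_d nz_c sf1 sg1 sf2 sg2 tan1 tan2 det; split=> //=.
set F1 := homogenize d1 f1; set G1 := homogenize d1 g1.
set F2 := homogenize d2 f2; set G2 := homogenize d2 g2.
have detH : F1 * G2 - F2 * G1 = c *: arr_form t m.
  rewrite -homogenize_arr_poly -sum_d -homogenizeZ -det homogenizeB.
  by rewrite [f2 * g1]mulrC !homogenizeM // [F2 * G1]mulrC.
have tanH1 : tangent_form t m F1 G1 by apply: tangent_form_homogenize.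
have tanH2 : tangent_form t m F2 G2 by apply: tangent_form_homogenize.
have nz_det : F1 * G2 - F2 * G1 != 0.
  by rewrite detH scaler_eq0 negb_or nz_c arr_form_neq0.
have [X10 X11] := derivation_ofX F1 G1; have [X20 X21] := derivation_ofX F2 G2.
have hom d (f g : {poly K}) : (homogenize d f != 0) || (homogenize d g != 0) ->
    homog_derivation d (derivation_of (homogenize d f) (homogenize d g)).
  have [X0 X1] := derivation_ofX (homogenize d f) (homogenize d g).
  move=> nz; split; first exact: derivation_ofP.
    by case/orP: nz => nz; [exists 'X_0 | exists 'X_1]; rewrite ?X0 ?X1.
  by move=> i; have [->|->] := ord2P i; rewrite ?X0 ?X1 homogenize_dhomog.
exists (derivation_of F1 G1), (derivation_of F2 G2); split; last first.
- apply: hom; apply: contraNT nz_det; rewrite negb_or !negbK => /andP[/eqP F0 /eqP G0].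
  by rewrite /F2 /G2 F0 G0 mul0r mulr0 subrr.
- apply: hom; apply: contraNT nz_det; rewrite negb_or !negbK => /andP[/eqP F0 /eqP G0].
  by rewrite /F1 /G1 F0 G0 mul0r mulr0 subrr.
split.
- by split; apply/der_moduleP; rewrite ?X10 ?X11 ?X20 ?X21; split=> //; apply: derivation_ofP.
- move=> theta /der_moduleP [der tan].
  have [A [B [EF EG]]] := saito inj_t nz_c detH tanH1 tanH2 tan.
  exists A, B => P; rewrite (derivationE der) EF EG /derivation_of.
  by ring.
move=> A B AB0; move: (AB0 'X_0) (AB0 'X_1); rewrite X10 X11 X20 X21 => E0 E1.
split; apply: (mulfI nz_det); rewrite mulr0.
  transitivity ((A * F1 + B * F2) * G2 - (A * G1 + B * G2) * F2); first by ring.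
  by rewrite E0 E1 !mul0r subrr.
transitivity ((A * G1 + B * G2) * F1 - (A * F1 + B * F2) * G1); first by ring.
by rewrite E0 E1 !mul0r subrr.
Qed.

End Exponents.

(** Passing from m to m' adds one to the multiplicity of the point i0. *)
Section OddStep.
Variables (K : numFieldType) (n k : nat) (m m' : 'I_n -> nat) (t : 'I_n -> K) (i0 : 'I_n).
Hypothesis sum_m : (\sum_i m i = k.*2)%N.
Hypothesis inj_t : injective t.
Hypothesis m'E : forall i, m' i = (m i + (i == i0))%N.
Variables f1 g1 f2 g2 : {poly K}.
Hypothesis fr : frame k m t f1 g1 f2 g2.

Lemma arr_poly_succ : arr_poly m' t = ('X - (t i0)%:P) * arr_poly m t.
Proof.
rewrite /arr_poly (bigD1 i0) //= [in RHS](bigD1 i0) //= m'E eqxx addn1 exprS -mulrA.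
by congr (_ * (_ * _)); apply: eq_bigr => i /negbTE ne_i; rewrite m'E ne_i addn0.
Qed.

Lemma tangents_succ f g w : tangents m t f g ->
  g - t i0 *: f = ('X - (t i0)%:P) ^+ m i0 * w -> w.[t i0] = 0 -> tangents m' t f g.
Proof.
move=> tan wE w0 i; rewrite m'E; have [->|_] := eqVneq i i0; last by rewrite addn0.
have /dvdpP [w' w'E] : 'X - (t i0)%:P %| w by rewrite dvdp_XsubCl rootE w0.
by rewrite addn1 exprSr wE w'E [w' * _]mulrC mulrA dvdp_mulr.
Qed.

(** Let c1 and c2 be the values at t_{i0} of the quotients of the tangency
conditions of the two elements of a frame; [frame_local] shows that they are not both
zero.  The combination c1 (f2, g2) - c2 (f1, g1) is tangent to one order more, and the
other generator is (X - t_{i0}) times an element of the frame whose value is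
nonzero. *)
Lemma frame_succ : exists (c : K) (f g f' g' : {poly K}), [/\ c != 0,
  (size f <= k.+1)%N /\ (size g <= k.+1)%N, (size f' <= k.+2)%N /\ (size g' <= k.+2)%N,
  tangents m' t f g /\ tangents m' t f' g' & f * g' - f' * g = c *: arr_poly m' t].
Proof.
have det := frame_det sum_m inj_t fr.
case: fr => [[sf1 sg1 sf2 sg2] [tan1 tan2] _ _].
have /dvdpP [u1] := tan1 i0; rewrite mulrC => E1.
have /dvdpP [u2] := tan2 i0; rewrite mulrC => E2.
pose c1 := u1.[t i0]; pose c2 := u2.[t i0]; pose Z := 'X - (t i0)%:P.
have nz_c : (c1 != 0) || (c2 != 0).
  apply: contraT; rewrite negb_or !negbK => /andP[/eqP c10 /eqP c20].
  have := frame_local sum_m inj_t fr E1 E2.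
  by rewrite hornerD hornerN !hornerM -/c1 -/c2 c10 c20 !mulr0 subrr eqxx.
pose f := c1 *: f2 + (- c2) *: f1; pose g := c1 *: g2 + (- c2) *: g1.
have sz (p q : {poly K}) a b : (size p <= k.+1)%N -> (size q <= k.+1)%N ->
    (size (a *: p + b *: q)%R <= k.+1)%N.
  move=> sp sq; rewrite (leq_trans (size_polyD _ _)) // geq_max.
  by rewrite !(leq_trans (size_scale_leq _ _)).
have szZ (p : {poly K}) : (size p <= k.+1)%N -> (size (Z * p)%R <= k.+2)%N.
  move=> sp; rewrite (leq_trans (size_polyMleq _ _)) // size_XsubC; exact: sp.
have tan : tangents m' t f g.
  apply: (tangents_succ (w := c1 *: u2 + (- c2) *: u1)); first exact: tangents_lin.
    rewrite mulrDr -!scalerAr -E1 -E2 /f /g -!mul_polyC; ring.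
  by rewrite hornerD !hornerZ -/c1 -/c2; ring.
have tanZ (p q u : {poly K}) : tangents m t p q ->
    q - t i0 *: p = Z ^+ m i0 * u -> tangents m' t (Z * p) (Z * q).
  move=> tanp Eu; apply: (tangents_succ (w := Z * u)).
  - by move=> i; rewrite scalerAr -mulrBr dvdp_mull // tanp.
  - by rewrite scalerAr -mulrBr Eu mulrCA.
  by rewrite hornerM hornerXsubC subrr mul0r.
have [c10|nz1] := eqVneq c1 0.
  rewrite c10 eqxx /= in nz_c.
  exists (- c2), f, g, (Z * f2), (Z * g2); split=> //.
  - by rewrite oppr_eq0.
  - by split; apply: sz.
  - by split; apply: szZ.
  - by split=> //; apply: tanZ tan2 E2.
  rewrite arr_poly_succ -det /f /g c10 !scale0r !add0r -!mul_polyC !polyCN /Z; ring.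
exists (- c1), f, g, (Z * f1), (Z * g1); split=> //.
- by rewrite oppr_eq0.
- by split; apply: sz.
- by split; apply: szZ.
- by split=> //; apply: tanZ tan1 E1.
by rewrite arr_poly_succ -det /f /g -!mul_polyC !polyCN /Z; ring.
Qed.

End OddStep.

(** * The open set *)

Section Generic.
Variables (K : numFieldType) (n : nat).

Definition line_of (v : 'rV[K]_2) (nz : v != 0) : proj_line K.
Proof. by exists <[v]>%VS; rewrite dim_vline nz. Defined.

Definition affine_slope (v : 'M[K]_(n, 2)) i := v i 1 / v i 0.

Lemma homog_coords_line (p : 'I_n -> proj_line K) v i (w : 'rV[K]_2) :
  homog_coords p v -> v i 0 != 0 ->
  (w \in val (p i)) = (w 0 1 == affine_slope v i * w 0 0).
Proof.
move=> /(_ i) [nz_v v_p] nz_a.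
have -> : val (p i) = <[row i v]>%VS.
  apply/eqP; rewrite eq_sym eqEdim dim_vline nz_v (eqP (valP (p i))) andbT.
  by rewrite -memvE.
apply/vlineP/eqP => [[c ->]|w1].
  by rewrite !mxE /affine_slope mulrCA divfK.
exists (w 0 0 / v i 0); apply/rowP => j; rewrite !mxE.
have [->|->] := ord2P j; first by rewrite divfK.
by rewrite w1 [LHS]mulrC mulrA [RHS]mulrAC.
Qed.

Lemma affine_slope_inj (p : 'I_n -> proj_line K) v :
  homog_coords p v -> (forall i, v i 0 != 0) -> injective p -> injective (affine_slope v).
Proof.
move=> hv nz_a inj_p i j eq_ij; apply: inj_p; apply: val_inj; apply/vspaceP => w.
by rewrite !(homog_coords_line _ hv) // eq_ij.
Qed.

Section Even.
Variables (k : nat) (m : 'I_n -> nat).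
Hypothesis le_mk : forall i, (m i <= k)%N.
Hypothesis sum_m : (\sum_i m i = k.*2)%N.
Hypothesis m_gt0 : forall i, (0 < m i)%N.

(** The second factor keeps all points in the affine chart. *)
Definition generic_poly : {mpoly K[n * 2]} :=
  \det (sysmx le_mk sum_m (@acoord K n) (@bcoord K n)) * \prod_i acoord K i.

Lemma multihomog_generic : exists d, multihomog d generic_poly.
Proof.
have [d hd] := multihomog_det_sysmx K le_mk sum_m m_gt0.
by eexists; apply: (multihomogM hd (@multihomog_prod_acoord K n)).
Qed.

Lemma meval_generic (v : 'M[K]_(n, 2)) : generic_poly.@[mxvec v 0] =
  \det (sysmx le_mk sum_m (fun i => v i 0) (fun i => v i 1)) * \prod_i v i 0.
Proof.
have aE i : (acoord K i).@[mxvec v 0] = v i 0 by rewrite mevalXU mxvecE.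
have bE i : (bcoord K i).@[mxvec v 0] = v i 1 by rewrite mevalXU mxvecE.
have faE : meval (mxvec v 0) \o @acoord K n = fun i => v i 0 by apply: funext.
have fbE : meval (mxvec v 0) \o @bcoord K n = fun i => v i 1 by apply: funext.
rewrite /generic_poly mevalM -det_map_mx map_sysmx faE fbE rmorph_prod.
by rewrite (eq_bigr _ (fun i _ => aE i)).
Qed.

Lemma generic_affine (v : 'M[K]_(n, 2)) : generic_poly.@[mxvec v 0] != 0 ->
  (forall i, v i 0 != 0) /\
  forall f g, solves k m (fun=> 1) (affine_slope v) f g -> f = 0 /\ g = 0.
Proof.
rewrite meval_generic mulf_eq0 negb_or => /andP[det_nz /prodf_neq0 nz_a].
have {}nz_a i : v i 0 != 0 by apply: nz_a.
split=> // f g /(iffLR (solves_scale k m (fun i => v i 1) f g nz_a)) sol.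
have [f0|nz_f] := eqVneq f 0; have [g0|nz_g] := eqVneq g 0 => //;
  by case/eqP: det_nz; apply: (solves_det0 le_mk sum_m sol); rewrite ?nz_f ?nz_g ?orbT.
Qed.

Lemma generic_nonzero : (1 < n)%N -> (n <= k.+1)%N ->
  exists p : 'I_n -> proj_line K, ~ vanishes_at generic_poly p.
Proof.
move=> n_gt1 le_nk; pose ms := [seq m i | i <- enum 'I_n].
have size_ms : size ms = n by rewrite size_map size_enum_ord.
have sum_ms : sumn ms = k.*2.
  by rewrite -sum_m sumnE big_map big_enum.
have [||||s [snd_s _ rig]] := @rigid_points_exist K ms k; rewrite ?size_ms //.
  by apply/allP => x /mapP [i _ ->]; rewrite m_gt0 le_mk.
rewrite sum_ms doubleK in rig.
have size_s : size s = n by rewrite -size_ms -snd_s size_map.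
pose t (i : 'I_n) := (nth (0, 0%N) s i).1.
have mE (i : 'I_n) : (nth (0, 0%N) s i).2 = m i.
  rewrite -(nth_map (0, 0%N) 0%N) ?size_s // snd_s (nth_map i) ?size_enum_ord //.
  by rewrite nth_ord_enum.
pose v : 'M[K]_(n, 2) := \matrix_(i, j) (if j == 0 then 1 else t i).
have v0 i : v i 0 = 1 by rewrite mxE.
have v1 i : v i 1 = t i by rewrite mxE.
have nz_v i : row i v != 0.
  by apply/eqP => /rowP /(_ 0) /eqP; rewrite !mxE /= oner_eq0.
exists (fun i => line_of (nz_v i)) => van.
have /eqP := van v (fun i => conj (nz_v i) (memv_line _)).
apply/negP; rewrite meval_generic mulf_neq0 //; last first.
  by apply/prodf_neq0 => i _; rewrite v0 oner_eq0.
apply: no_solution_det => [i|f g]; first by rewrite v0 oner_eq0.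
have -> : (fun i => v i 0) = (fun=> 1) by apply: funext.
have -> : (fun i => v i 1) = t by apply: funext.
move/solves_tangent => [sf sg tan]; apply: rig => //.
apply/allP => x xs; have lt_i : (index x s < n)%N by rewrite -size_s index_mem.
have := tan (Ordinal lt_i); rewrite -mE /t /=.
by rewrite nth_index.
Qed.

Lemma generic_frame (t : 'I_n -> K) :
  (forall f g, solves k m (fun=> 1) t f g -> f = 0 /\ g = 0) ->
  exists f1 g1 f2 g2, frame k m t f1 g1 f2 g2.
Proof.
move=> rig; have [f1 [g1 [[sf1 sg1] tan1 f1k g1k]]] := frame_exists le_mk sum_m rig 1 0.
have [f2 [g2 [[sf2 sg2] tan2 f2k g2k]]] := frame_exists le_mk sum_m rig 0 1.
by exists f1, g1, f2, g2.
Qed.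

(** The part of the argument common to the two parities of the total multiplicity:
a generic configuration is affine and has a frame. *)
Lemma generic_exponents (P : ('I_n -> proj_line K) -> Prop) :
  (1 < n)%N -> (n <= k.+1)%N ->
  (forall (p : 'I_n -> proj_line K) (t : 'I_n -> K), injective t ->
     (forall i (w : 'rV_2), (w \in val (p i)) = (w 0 1 == t i * w 0 0)) ->
     (exists f1 g1 f2 g2, frame k m t f1 g1 f2 g2) -> P p) ->
  exists U : ('I_n -> proj_line K) -> Prop,
    [/\ zariski_open U, (exists p, U p) & forall p, U p -> injective p -> P p].
Proof.
move=> n_gt1 le_nk HP; exists (fun p => ~ vanishes_at generic_poly p); split.
- exists (fun F => F = generic_poly); split=> [F ->|p]; first exact: multihomog_generic.
  by split=> [/contrapT van F ->|van nvan] //; apply: nvan; apply: van.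
- exact: generic_nonzero.
move=> p nvan inj_p.
have [v [hv nz]] : exists v, homog_coords p v /\ generic_poly.@[mxvec v 0] != 0.
  apply: contrapT => none; apply: nvan => v hv; apply/eqP; apply: contraT => nz.
  by case: none; exists v.
have [nz_a rig] := generic_affine nz.
apply: (HP p (affine_slope v)).
- exact: affine_slope_inj hv nz_a inj_p.
- by move=> i w; apply: homog_coords_line.
exact: generic_frame rig.
Qed.

End Even.
End Generic.

(** For an even total multiplicity a frame is a basis.  For an odd one the
largest multiplicity m_0 is lowered by one; it stays positive, because m_0 = 1
would give N = n >= 2n - 2, hence N = n = 2, which is even. *)
Theorem generic_exponents_balanced (K : numFieldType) (n : nat) (hn : (2 <= n)%N)
    (m : 'I_n -> nat) :
  (forall i, (0 < m i)%N) ->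
  (forall i j : 'I_n, (i <= j)%N -> (m j <= m i)%N) ->
  (m (@Ordinal n 0 (ltnW hn)) <= \sum_(i < n | (0 < i)%N) m i)%N ->
  (2 * n - 2 <= \sum_(i < n) m i)%N ->
  exists U : ('I_n -> proj_line K) -> Prop,
    [/\ zariski_open U,
        (exists p, U p)
      & forall p, U p -> injective p ->
          exponents p m ((\sum_(i < n) m i)./2, uphalf (\sum_(i < n) m i))].
Proof.
move=> m_gt0 m_sorted m_bal m_large.
set i0 := Ordinal _ in m_bal; set N := (\sum_i m i)%N in m_large *.
have m_max i : (m i <= m i0)%N by apply: m_sorted.
have NE : N = (m i0 + \sum_(i < n | (0 < i)%N) m i)%N.
  rewrite /N (bigD1 i0) //=; congr (_ + _)%N; apply: eq_bigl => i.
  by rewrite -val_eqE /= lt0n.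
have le_m0 : ((m i0).*2 <= N)%N by rewrite NE -addnn leq_add2l.
have := odd_double_half N; case: (boolP (odd N)) => odd_N NhE; last first.
  have -> : uphalf N = N./2 by rewrite uphalf_half (negbTE odd_N).
  have sum_m : (\sum_i m i = N./2.*2)%N by rewrite -/N; lia.
  have le_mk i : (m i <= N./2)%N by have := m_max i; lia.
  apply: (generic_exponents le_mk sum_m m_gt0) => //; first by lia.
  move=> p t inj_t p_line [f1 [g1 [f2 [g2 fr]]]].
  have [[sf1 sg1 sf2 sg2] [tan1 tan2] _ _] := fr.
  apply: (exponents_of_pair inj_t p_line (c := 1) _ _ _ sf1 sg1 sf2 sg2 tan1 tan2) => //.
  - by rewrite sum_m addnn.
  - by rewrite oner_eq0.
  by rewrite scale1r (frame_det sum_m inj_t fr).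
have -> : uphalf N = N./2.+1 by rewrite uphalf_half odd_N.
pose m' i := (m i - (i == i0))%N.
have mE i : m i = (m' i + (i == i0))%N.
  by rewrite /m' subnK //; case: eqP => // _; apply: m_gt0.
have sum_m' : (\sum_i m' i = N./2.*2)%N.
  have : N = (\sum_i m' i + 1)%N.
    rewrite /N (eq_bigr _ (fun i _ => mE i)) big_split /=; congr (_ + _)%N.
    by rewrite (bigD1 i0) //= ?eqxx big1 // => i /negbTE ->.
  by lia.
have m0_gt1 : (1 < m i0)%N.
  rewrite ltnNge; apply/negP => m0_le1.
  have : (N <= n)%N.
    rewrite -[X in (_ <= X)%N](card_ord n) -sum1_card leq_sum // => i _.
    exact: leq_trans (m_max i) m0_le1.
  by lia.
have m'_gt0 i : (0 < m' i)%N.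
  by rewrite /m'; have := m_gt0 i; case: eqP => [->|_]; lia.
have le_mk i : (m' i <= N./2)%N.
  by rewrite /m'; have := m_max i; case: eqP => [->|_] /=; lia.
apply: (generic_exponents le_mk sum_m' m'_gt0) => //; first by lia.
move=> p t inj_t p_line [f1 [g1 [f2 [g2 fr]]]].
have [c [f [g [f' [g' [nz_c [sf sg] [sf' sg'] [tan tan'] det]]]]]] :=
  frame_succ sum_m' inj_t mE fr.
apply: (exponents_of_pair inj_t p_line _ _ nz_c sf sg sf' sg' tan tan' det) => //.
by rewrite -/N; lia.
Qed.

Theorem theorem3p1 (R : realType) (n : nat) (hn : (2 <= n)%N)
    (m : 'I_n -> nat)
    (m_pos : forall i, (0 < m i)%N)
    (m_sorted : forall i j : 'I_n, (i <= j)%N -> (m j <= m i)%N)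
    (m_balanced : (m (@Ordinal n 0 (ltnW hn)) <= \sum_(i < n | (0 < i)%N) m i)%N)
    (m_large : (2 * n - 2 <= \sum_(i < n) m i)%N) :
  exists U : ('I_n -> proj_line R[i]) -> Prop,
    [/\ zariski_open U,
        (exists p, U p)
      & forall p, U p -> injective p ->
          exponents p m ((\sum_(i < n) m i)./2, uphalf (\sum_(i < n) m i))].
Proof. exact: generic_exponents_balanced. Qed.
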